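(* Let $g\in H(\mathbb{D})$ satisfy $g',\frac{1}{g'}\in H^\infty$. Let $v\colon[0,1)\to(0,\infty)$ be a log-convex weight function such that: there exist $\alpha>0$ and $r_0\in(0,1)$ for which $v(r)(1-r)^{-\alpha}$ is increasing on $[r_0,1)$; and there exist (possibly different) $\alpha'>0$ and $r_0'\in(0,1)$ for which $v(r)(1-r)^{-\alpha'}$ is decreasing on $[r_0',1)$. Let $w(r):=(1-r)v(r)$ for $r\in[0,1)$. (i) Both operators $D\colon H^\infty_v\to H^\infty_w$ and $J\colon H^\infty_w\to H^\infty_v$ are continuous. (ii) Whenever the operator $V_g\colon H^\infty_v\to H^\infty_v$ is continuous, the optimal domain satisfies $[V_g,H^\infty_v]=H^\infty_w$ as linear subspaces of $H(\mathbb{D})$ and with equivalent norms. (iii) Suppose, in addition, that $\lim_{r\to1^-}v(r)=0$ and that the operator $V_g\colon H^0_v\to H^0_v$ is continuous. Then $[V_g,H^0_v]=H^0_w$ as linear subspaces of $H(\mathbb{D})$ and with equivalent norms.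
   Context: $\mathbb{D}=\{z\in\mathbb{C}:|z|<1\}$; $H(\mathbb{D})$ is the Fréchet space of all analytic functions on $\mathbb{D}$ with the topology of uniform convergence on compact sets; $H^\infty$ is the space of bounded analytic functions on $\mathbb{D}$. The condition $\frac1{g'}\in H^\infty$ means that $g'$ has no zeros in $\mathbb{D}$ and $1/g'$ is bounded. For $g\in H(\mathbb{D})$, $(V_gf)(z):=\int_0^z f(\xi)g'(\xi)\,d\xi$ for $f\in H(\mathbb{D})$. The differentiation operator is $Df:=f'$ and the integration operator is $(Jf)(z):=\int_0^zf(\xi)\,d\xi$, for $f\in H(\mathbb{D})$. A weight is a continuous, non-increasing function $v\colon[0,1)\to(0,\infty)$, extended to $\mathbb{D}$ by $v(z):=v(|z|)$. It is log-convex if $x\mapsto -\log v(e^x)$ is convex on $(-\infty,0)$. Define $H^\infty_v:=\{f\in H(\mathbb{D}):\|f\|_{\infty,v}:=\sup_{z\in\mathbb{D}}|f(z)|v(z)<\infty\}$ and $H^0_v:=\{f\in H(\mathbb{D}):\lim_{|z|\to1^-}|f(z)|v(z)=0\}$, both with norm $\|\cdot\|_{\infty,v}$ (similarly for $w$). For $X$ a Banach space continuously included in $H(\mathbb{D})$ and $T\colon H(\mathbb{D})\to H(\mathbb{D})$ continuous linear with $T(X)\subseteq X$, the optimal domain is $[T,X]:=\{f\in H(\mathbb{D}):Tf\in X\}$ with (semi-)norm $\|f\|_{[T,X]}:=\|Tf\|_X$. Saying that $T\colon X\to Y$ is continuous includes that $T(X)\subseteq Y$. *)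

(* Defs.v *)
From Stdlib Require Import Reals.
From Coquelicot Require Import Coquelicot.
Local Open Scope R_scope.

(* Functions on the unit disc are represented by total functions [C -> C]; every
   notion below depends only on their values on the disc. *)
Definition disc (z : C) : Prop := Cmod z < 1.

Definition analytic (f : C -> C) : Prop :=
  forall z : C, disc z -> @ex_derive C_AbsRing C_NormedModule f z.

Definition Hinf (f : C -> C) : Prop :=
  analytic f /\ exists M : R, forall z : C, disc z -> Cmod (f z) <= M.

(* Non-vanishing is stated separately since [Cinv 0] is a junk value. *)
Definition inv_Hinf (h : C -> C) : Prop :=
  (forall z : C, disc z -> h z <> RtoC 0) /\ Hinf (fun z => Cinv (h z)).

(* Path integral of [h] along the segment from 0 to [z]; for analytic [h] on the
   disc any other path in the disc gives the same value. *)
Definition integral_from_0 (h : C -> C) (z : C) : C :=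
  RInt (V := C_R_CompleteNormedModule)
    (fun t : R => Cmult (h (Cmult (RtoC t) z)) z) 0 1.

Definition op_D (f : C -> C) : C -> C := C_derive f.

Definition op_J (f : C -> C) : C -> C := integral_from_0 f.

Definition op_V (g f : C -> C) : C -> C :=
  integral_from_0 (fun xi => Cmult (f xi) (C_derive g xi)).

Definition unit_interval (r : R) : Prop := 0 <= r < 1.

(* Only the values of [v] on [0,1) matter; continuity is relative to [0,1), hence
   one-sided at 0. *)
Definition weight (v : R -> R) : Prop :=
  continuous_on unit_interval v /\
  (forall r : R, unit_interval r -> 0 < v r) /\
  (forall r s : R, unit_interval r -> unit_interval s -> r <= s -> v s <= v r).

Definition convex_on (I : R -> Prop) (phi : R -> R) : Prop :=
  forall x y t : R, I x -> I y -> 0 <= t <= 1 ->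
    phi (t * x + (1 - t) * y) <= t * phi x + (1 - t) * phi y.

Definition log_convex (v : R -> R) : Prop :=
  convex_on (fun x => x < 0) (fun x => - ln (v (exp x))).

(* Monotonicity is non-strict in the next two definitions; since the exponent is
   existentially quantified, the strict versions are equivalent (enlarge it in the
   first, shrink it in the second). *)
Definition eventually_increasing_quotient (v : R -> R) : Prop :=
  exists alpha r0 : R, 0 < alpha /\ 0 < r0 < 1 /\
    forall r s : R, r0 <= r -> r <= s -> s < 1 ->
      v r * Rpower (1 - r) (- alpha) <= v s * Rpower (1 - s) (- alpha).

Definition eventually_decreasing_quotient (v : R -> R) : Prop :=
  exists alpha r0 : R, 0 < alpha /\ 0 < r0 < 1 /\
    forall r s : R, r0 <= r -> r <= s -> s < 1 ->
      v s * Rpower (1 - s) (- alpha) <= v r * Rpower (1 - r) (- alpha).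

Definition sup_norm (v : R -> R) (f : C -> C) : Rbar :=
  Lub_Rbar (fun y : R => exists z : C, disc z /\ y = Cmod (f z) * v (Cmod z)).

(* A space of functions on the disc (carrier set and (semi-)norm); [fnorm] is only
   meaningful on members. *)
Record fspace : Type := FSpace {
  mem : (C -> C) -> Prop;
  fnorm : (C -> C) -> R
}.

Definition Hinf_weighted (v : R -> R) : fspace := {|
  mem := fun f => analytic f /\ Rbar_lt (sup_norm v f) p_infty;
  fnorm := fun f => real (sup_norm v f)
|}.

Definition H0_weighted (v : R -> R) : fspace := {|
  mem := fun f => analytic f /\
    forall eps : R, 0 < eps -> exists r : R, r < 1 /\
      forall z : C, r < Cmod z < 1 -> Cmod (f z) * v (Cmod z) < eps;
  fnorm := fun f => real (sup_norm v f)
|}.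

Definition optimal_domain (T : (C -> C) -> (C -> C)) (X : fspace) : fspace := {|
  mem := fun f => analytic f /\ mem X (T f);
  fnorm := fun f => fnorm X (T f)
|}.

Definition fminus (f h : C -> C) : C -> C := fun z => Cminus (f z) (h z).

Definition continuous_op (T : (C -> C) -> (C -> C)) (X Y : fspace) : Prop :=
  (forall f : C -> C, mem X f -> mem Y (T f)) /\
  (forall f : C -> C, mem X f ->
    forall eps : R, 0 < eps -> exists delta : R, 0 < delta /\
      forall h : C -> C, mem X h -> fnorm X (fminus h f) < delta ->
        fnorm Y (fminus (T h) (T f)) < eps).

Definition equal_with_equivalent_norms (X Y : fspace) : Prop :=
  (forall f : C -> C, mem X f <-> mem Y f) /\
  exists a b : R, 0 < a /\ 0 < b /\
    forall f : C -> C, mem X f ->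
      a * fnorm Y f <= fnorm X f /\ fnorm X f <= b * fnorm Y f.

(* Main.v *)
(* On weighted sup-norms [D] costs a factor [1 - |z|] and [J] gains one.  For [D] this is
   Cauchy's estimate on the circle of radius [(1 - |z|) / 2] about [z], where the
   increasing quotient makes [v] comparable to [v |z|].  For [J] it is integration along
   the radius: the decreasing quotient bounds [1 / v t] by a multiple of
   [(1 - r)^a (1 - t)^(-a) / v r] for [t <= r], and the integral of [(1 - t)^(-a-1)] is
   explicit.  Since [V_g f = J (f g')] and [(V_g f)' = f g'], where multiplication by [g']
   and by [1 / g'] is bounded, the optimal domain is the [w]-space.

   The Cauchy estimate needs no winding number.  Goursat's bisection gives [f] a primitive
   [F], which is continuously differentiable.  For a continuously differentiable [h],
   [m s = int_0^(2 pi) h (z + s e^(it)) e^(-it) dt] satisfies [m = s m'], hence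
   [m s = 2 pi s h'(z)].  Applying this to [F] writes [f] as an integral of [F], and
   differentiating under the integral sign yields the same formula for [f]. *)
From Stdlib Require Import Reals Lra Lia ClassicalEpsilon.
From Coquelicot Require Import Coquelicot.
(* Imported last: Coquelicot also defines a [disc]. *)
Require Import Defs.
Local Open Scope R_scope.

(** The obstacle is that [analytic] asserts only pointwise complex differentiability. Integration by
    parts on a circle and differentiation under the integral both need a continuous derivative, and
    nothing gives continuity of [C_derive f] in advance. A primitive [F] avoids this, since [F' = f]
    is continuous merely because [f] is differentiable. The formula obtained for [f] then makes
    [C_derive f] continuous. Using the same representation once more, now for the pair [f],
    [C_derive f], makes [C_derive f] analytic, as membership of [op_D f] in the target space
    demands.

    The two operator estimates are stated pointwise, with local data, so that the spaces defined by
    decay at the boundary are served by the same lemmas as those defined by boundedness. The Cauchy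
    estimate looks at a single circle, which moves to the boundary together with its centre. The
    radial estimate tolerates an additive constant [M], which absorbs the values of the function on
    a compact disc; its contribution [M * v |z|] dies out once [v] tends to 0. *)

(** * Inequalities for the complex modulus *)

Lemma Cmod_minus_sym (a b : C) : Cmod (a - b) = Cmod (b - a).
Proof. rewrite <- (Cmod_opp (a - b)). f_equal. ring. Qed.

Lemma Cmod_minus_triangle (a b c : C) : Cmod (a - c) <= Cmod (a - b) + Cmod (b - c).
Proof. replace (a - c)%C with ((a - b) + (b - c))%C by ring. apply Cmod_triangle. Qed.

Lemma Cmod_le_add_minus (a b : C) : Cmod a <= Cmod b + Cmod (a - b).
Proof. replace a with (b + (a - b))%C at 1 by ring. apply Cmod_triangle. Qed.

Lemma im_component_le_Cmod (z : C) : Rabs (snd z) <= Cmod z.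
Proof. apply Rle_trans with (2 := Rmax_Cmod z). apply Rmax_r. Qed.

Lemma re_component_le_Cmod (z : C) : Rabs (fst z) <= Cmod z.
Proof. apply Rle_trans with (2 := Rmax_Cmod z). apply Rmax_l. Qed.

Lemma Cmod_le_sum (z : C) : Cmod z <= Rabs (fst z) + Rabs (snd z).
Proof.
  unfold Cmod. rewrite <- (sqrt_Rsqr (Rabs (fst z) + Rabs (snd z))).
  - apply sqrt_le_1_alt. unfold Rsqr.
    pose proof (Rabs_pos (fst z)). pose proof (Rabs_pos (snd z)).
    rewrite <- (pow2_abs (fst z)), <- (pow2_abs (snd z)). nra.
  - pose proof (Rabs_pos (fst z)). pose proof (Rabs_pos (snd z)). lra.
Qed.

Lemma Cmod_RtoC_mult (r : R) (z : C) : 0 <= r -> Cmod (RtoC r * z) = r * Cmod z.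
Proof. intros Hr. rewrite Cmod_mult, Cmod_R, Rabs_pos_eq; trivial. Qed.

Lemma Cmod_eq_0_of_small (z : C) : (forall eps, 0 < eps -> Cmod z <= eps) -> z = 0%C.
Proof.
  intros H. apply Cmod_eq_0. apply Rle_antisym; [|apply Cmod_ge_0].
  apply le_epsilon. intros e He. specialize (H e He). lra.
Qed.

(** * Curves in the plane *)

Definition curve_continuous (f : R -> C) (t : R) : Prop :=
  continuous (fun s => fst (f s)) t /\ continuous (fun s => snd (f s)) t.

Definition curve_derive (f : R -> C) (t : R) (l : C) : Prop :=
  is_derive (fun s => fst (f s)) t (fst l) /\ is_derive (fun s => snd (f s)) t (snd l).

(** The little-o form of the complex derivative. The non-strict bound makes the increment [h = 0]
    harmless and lets error estimates be added without dividing by [h]. *)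
Definition Cdiff (f : C -> C) (z l : C) : Prop :=
  forall eps, 0 < eps -> exists delta, 0 < delta /\
    forall h, Cmod h < delta -> Cmod (f (z + h)%C - f z - l * h) <= eps * Cmod h.

Definition Ccont (f : C -> C) (z : C) : Prop :=
  forall eps, 0 < eps -> exists delta, 0 < delta /\
    forall h, Cmod h < delta -> Cmod (f (z + h)%C - f z) < eps.

Lemma is_derive_eps (f : R -> R) (x l : R) :
  is_derive f x l <-> (forall eps, 0 < eps -> exists delta, 0 < delta /\
    forall y, Rabs (y - x) < delta -> Rabs (f y - f x - (y - x) * l) <= eps * Rabs (y - x)).
Proof.
  rewrite is_derive_Reals. unfold derivable_pt_lim. split; intros H e He.
  - destruct (H e He) as [d Hd]. exists d. split; [apply cond_pos|]. intros y Hy.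
    destruct (Req_dec (y - x) 0) as [E|E].
    + replace y with x by lra. replace (f x - f x - (x - x) * l) with 0 by ring.
      rewrite Rabs_R0. apply Rmult_le_pos; [lra | apply Rabs_pos].
    + specialize (Hd (y - x) E Hy). replace (x + (y - x)) with y in Hd by ring.
      replace (f y - f x - (y - x) * l) with (((f y - f x) / (y - x) - l) * (y - x)) by (field; auto).
      rewrite Rabs_mult. apply Rmult_le_compat_r; [apply Rabs_pos|lra].
  - destruct (H (e / 2)) as [d [Hd0 Hd]]; [lra|]. exists (mkposreal d Hd0). simpl. intros h Hh0 Hh.
    specialize (Hd (x + h)). replace (x + h - x) with h in Hd by ring. specialize (Hd Hh).
    replace ((f (x + h) - f x) / h - l) with ((f (x + h) - f x - h * l) / h) by (field; auto).
    unfold Rdiv. rewrite Rabs_mult, Rabs_inv.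
    assert (0 < Rabs h) by (apply Rabs_pos_lt; auto).
    apply Rle_lt_trans with (e / 2 * Rabs h * / Rabs h).
    + apply Rmult_le_compat_r; [|exact Hd]. left. apply Rinv_0_lt_compat. auto.
    + field_simplify; lra.
Qed.

(** Bridge between the componentwise form, to which real calculus applies, and the modulus form,
    which composes with [Cdiff]. *)
Lemma curve_derive_eps (f : R -> C) (t : R) (l : C) :
  curve_derive f t l <-> (forall eps, 0 < eps -> exists delta, 0 < delta /\
    forall s, Rabs (s - t) < delta -> Cmod (f s - f t - RtoC (s - t) * l) <= eps * Rabs (s - t)).
Proof.
  unfold curve_derive. split.
  - intros [H1 H2] e He. rewrite is_derive_eps in H1, H2.
    destruct (H1 (e / 2)) as [d1 [Hd1 K1]]; [lra|]. destruct (H2 (e / 2)) as [d2 [Hd2 K2]]; [lra|].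
    exists (Rmin d1 d2). split; [apply Rmin_pos; auto|]. intros s Hs.
    eapply Rle_trans; [apply Cmod_le_sum|].
    specialize (K1 s (Rlt_le_trans _ _ _ Hs (Rmin_l _ _))).
    specialize (K2 s (Rlt_le_trans _ _ _ Hs (Rmin_r _ _))).
    simpl in *.
    replace (fst (f s) + - fst (f t) + - ((s - t) * fst l - 0 * snd l))
      with (fst (f s) - fst (f t) - (s - t) * fst l) by ring.
    replace (snd (f s) + - snd (f t) + - ((s - t) * snd l + 0 * fst l))
      with (snd (f s) - snd (f t) - (s - t) * snd l) by ring.
    lra.
  - intros H. split; apply is_derive_eps; intros e He; destruct (H e He) as [d [Hd K]];
      exists d; (split; [exact Hd|]); intros s Hs; specialize (K s Hs);
      eapply Rle_trans; try exact K.
    + eapply Rle_trans; [|apply re_component_le_Cmod]. simpl. right. f_equal. ring.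
    + eapply Rle_trans; [|apply im_component_le_Cmod]. simpl. right. f_equal. ring.
Qed.

Lemma continuous_eps (f : R -> R) (x : R) :
  continuous f x <-> (forall eps, 0 < eps -> exists delta, 0 < delta /\
    forall y, Rabs (y - x) < delta -> Rabs (f y - f x) < eps).
Proof.
  split.
  - intros H e He. apply filterlim_locally with (eps := mkposreal e He) in H.
    destruct H as [d Hd]. exists d. split; [apply cond_pos|]. intros y Hy. exact (Hd y Hy).
  - intros H. apply filterlim_locally. intros e. destruct (H e (cond_pos e)) as [d [Hd K]].
    exists (mkposreal d Hd). intros y Hy. exact (K y Hy).
Qed.

Lemma curve_continuous_eps (f : R -> C) (t : R) :
  curve_continuous f t <-> (forall eps, 0 < eps -> exists delta, 0 < delta /\
    forall s, Rabs (s - t) < delta -> Cmod (f s - f t) < eps).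
Proof.
  unfold curve_continuous. rewrite !continuous_eps. split.
  - intros [H1 H2] e He.
    destruct (H1 (e / 2)) as [d1 [Hd1 K1]]; [lra|]. destruct (H2 (e / 2)) as [d2 [Hd2 K2]]; [lra|].
    exists (Rmin d1 d2). split; [apply Rmin_pos; auto|]. intros s Hs.
    eapply Rle_lt_trans; [apply Cmod_le_sum|].
    specialize (K1 s (Rlt_le_trans _ _ _ Hs (Rmin_l _ _))).
    specialize (K2 s (Rlt_le_trans _ _ _ Hs (Rmin_r _ _))).
    simpl. unfold Rminus in *. lra.
  - intros H. split; intros e He; destruct (H e He) as [d [Hd K]];
      exists d; (split; [exact Hd|]); intros s Hs; specialize (K s Hs);
      eapply Rle_lt_trans; try exact K.
    + apply (re_component_le_Cmod (f s - f t)).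
    + apply (im_component_le_Cmod (f s - f t)).
Qed.

Lemma curve_continuous_const (c : C) (t : R) : curve_continuous (fun _ => c) t.
Proof. split; apply continuous_const. Qed.

Lemma curve_continuous_plus (f g : R -> C) (t : R) :
  curve_continuous f t -> curve_continuous g t -> curve_continuous (fun s => f s + g s)%C t.
Proof.
  intros [F1 F2] [G1 G2]. split; simpl;
    [apply (continuous_plus _ _ _ F1 G1) | apply (continuous_plus _ _ _ F2 G2)].
Qed.

Lemma curve_continuous_opp (f : R -> C) (t : R) :
  curve_continuous f t -> curve_continuous (fun s => - f s)%C t.
Proof.
  intros [F1 F2]. split; simpl;
    [apply (continuous_opp _ _ F1) | apply (continuous_opp _ _ F2)].
Qed.

Lemma curve_continuous_minus (f g : R -> C) (t : R) :
  curve_continuous f t -> curve_continuous g t -> curve_continuous (fun s => f s - g s)%C t.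
Proof. intros F G. apply curve_continuous_plus; [exact F|]. apply curve_continuous_opp, G. Qed.

Lemma curve_continuous_mult (f g : R -> C) (t : R) :
  curve_continuous f t -> curve_continuous g t -> curve_continuous (fun s => f s * g s)%C t.
Proof.
  intros [F1 F2] [G1 G2]. split; simpl.
  - apply (continuous_minus (V := R_NormedModule) (fun s => fst (f s) * fst (g s))
      (fun s => snd (f s) * snd (g s)));
      [apply (continuous_mult _ _ _ F1 G1) | apply (continuous_mult _ _ _ F2 G2)].
  - apply (continuous_plus (V := R_NormedModule) (fun s => fst (f s) * snd (g s))
      (fun s => snd (f s) * fst (g s)));
      [apply (continuous_mult _ _ _ F1 G2) | apply (continuous_mult _ _ _ F2 G1)].
Qed.

Lemma curve_continuous_comp (h : C -> C) (f : R -> C) (t : R) :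
  curve_continuous f t -> Ccont h (f t) -> curve_continuous (fun s => h (f s)) t.
Proof.
  rewrite !curve_continuous_eps. intros F H e He.
  destruct (H e He) as [d [Hd K]]. destruct (F d Hd) as [d' [Hd' K']].
  exists d'. split; [exact Hd'|]. intros s Hs.
  specialize (K (f s - f t)%C (K' s Hs)). replace (f t + (f s - f t))%C with (f s) in K by ring.
  exact K.
Qed.

Lemma curve_derive_continuous (f : R -> C) (t : R) (l : C) :
  curve_derive f t l -> curve_continuous f t.
Proof.
  intros [H1 H2]. split; [apply (ex_derive_continuous (fun s => fst (f s)))
    | apply (ex_derive_continuous (fun s => snd (f s)))]; eexists; eassumption.
Qed.

Lemma curve_derive_const (c : C) (t : R) : curve_derive (fun _ => c) t 0%C.
Proof. split; apply (is_derive_const (K := R_AbsRing) (V := R_NormedModule)). Qed.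

Lemma curve_derive_RtoC (t : R) : curve_derive RtoC t 1%C.
Proof. split; simpl; [apply (is_derive_id (K := R_AbsRing))
  | apply (is_derive_const (K := R_AbsRing) (V := R_NormedModule))]. Qed.

Lemma curve_derive_ext_value (f : R -> C) (t : R) (l l' : C) :
  l = l' -> curve_derive f t l -> curve_derive f t l'.
Proof. intros ->. trivial. Qed.

Lemma curve_derive_plus (f g : R -> C) (t : R) (l m : C) :
  curve_derive f t l -> curve_derive g t m -> curve_derive (fun s => f s + g s)%C t (l + m)%C.
Proof.
  intros [F1 F2] [G1 G2]. split; simpl;
    [apply (is_derive_plus _ _ _ _ _ F1 G1) | apply (is_derive_plus _ _ _ _ _ F2 G2)].
Qed.

Lemma curve_derive_mult (f g : R -> C) (t : R) (l m : C) :
  curve_derive f t l -> curve_derive g t m ->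
  curve_derive (fun s => f s * g s)%C t (l * g t + f t * m)%C.
Proof.
  intros [F1 F2] [G1 G2].
  assert (P : forall a b : R, mult a b = mult b a) by apply Rmult_comm.
  pose proof (is_derive_mult _ _ _ _ _ F1 G1 P) as A.
  pose proof (is_derive_mult _ _ _ _ _ F2 G2 P) as B.
  pose proof (is_derive_mult _ _ _ _ _ F1 G2 P) as D.
  pose proof (is_derive_mult _ _ _ _ _ F2 G1 P) as E.
  split; simpl.
  - evar_last; [apply (is_derive_minus _ _ _ _ _ A B)|].
    unfold minus, plus, opp, mult; simpl. ring.
  - evar_last; [apply (is_derive_plus _ _ _ _ _ D E)|].
    unfold minus, plus, opp, mult; simpl. ring.
Qed.

(** The error splits into the error of [h] at the increment [f s - f t] and [m] times the error of
    [f]; each gets half of the tolerance. *)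
Lemma curve_derive_comp (h : C -> C) (f : R -> C) (t : R) (l m : C) :
  curve_derive f t l -> Cdiff h (f t) m -> curve_derive (fun s => h (f s)) t (m * l)%C.
Proof.
  intros F H. pose proof (curve_derive_continuous _ _ _ F) as Fc.
  rewrite curve_derive_eps in *. rewrite curve_continuous_eps in Fc.
  intros e He.
  (* [A] bounds the difference quotients of [f] near [t], whose error is at most 1 there, and [B]
     dominates [Cmod m]. The [+ 1] also keeps both divisors positive. *)
  set (A := Cmod l + 1). set (B := Cmod m + 1).
  assert (HA : 0 < A) by (pose proof (Cmod_ge_0 l); unfold A; lra).
  assert (HB : 0 < B) by (pose proof (Cmod_ge_0 m); unfold B; lra).
  destruct (H (e / (2 * A))) as [d [Hd K]].
  { apply Rdiv_lt_0_compat; lra. }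
  destruct (Fc d Hd) as [d1 [Hd1 K1]].
  destruct (F 1 Rlt_0_1) as [d2 [Hd2 K2]].
  destruct (F (e / (2 * B))) as [d3 [Hd3 K3]].
  { apply Rdiv_lt_0_compat; lra. }
  exists (Rmin d1 (Rmin d2 d3)). split; [repeat apply Rmin_pos; auto|]. intros s Hs.
  assert (S1 : Rabs (s - t) < d1) by (apply Rlt_le_trans with (1 := Hs), Rmin_l).
  assert (S2 : Rabs (s - t) < d2).
  { apply Rlt_le_trans with (1 := Hs). apply Rle_trans with (1 := Rmin_r _ _), Rmin_l. }
  assert (S3 : Rabs (s - t) < d3).
  { apply Rlt_le_trans with (1 := Hs). apply Rle_trans with (1 := Rmin_r _ _), Rmin_r. }
  specialize (K1 s S1). specialize (K2 s S2). specialize (K3 s S3).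
  specialize (K (f s - f t)%C K1). replace (f t + (f s - f t))%C with (f s) in K by ring.
  replace (h (f s) - h (f t) - RtoC (s - t) * (m * l))%C
    with ((h (f s) - h (f t) - m * (f s - f t)) + m * (f s - f t - RtoC (s - t) * l))%C by ring.
  eapply Rle_trans; [apply Cmod_triangle|].
  assert (L : Cmod (f s - f t) <= A * Rabs (s - t)).
  { eapply Rle_trans; [apply (Cmod_le_add_minus _ (RtoC (s - t) * l)%C)|].
    rewrite Cmod_mult, Cmod_R. unfold A. lra. }
  rewrite (Cmod_mult m).
  set (q := Rabs (s - t)) in *. assert (0 <= q) by apply Rabs_pos.
  assert (e / (2 * A) * Cmod (f s - f t) <= e / 2 * q).
  { apply Rle_trans with (e / (2 * A) * (A * q)).
    - apply Rmult_le_compat_l; [|exact L]. left. apply Rdiv_lt_0_compat; lra.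
    - right. field. lra. }
  assert (Cmod m * Cmod (f s - f t - RtoC (s - t) * l) <= e / 2 * q).
  { apply Rle_trans with (B * (e / (2 * B) * q)).
    - apply Rmult_le_compat; try apply Cmod_ge_0; [unfold B; lra | exact K3].
    - right. field. lra. }
  lra.
Qed.

(** * Integrals of complex-valued curves *)

Definition CInt (f : R -> C) (a b : R) : C := RInt (V := C_R_CompleteNormedModule) f a b.

Lemma is_RInt_CInt (f : R -> C) (a b : R) (l : C) :
  is_RInt (fun t => fst (f t)) a b (fst l) -> is_RInt (fun t => snd (f t)) a b (snd l) ->
  CInt f a b = l.
Proof.
  intros H1 H2. apply (is_RInt_unique (V := C_R_CompleteNormedModule)).
  destruct l as [l1 l2]. apply (is_RInt_fct_extend_pair (U := R_NormedModule) (V := R_NormedModule) f a b l1 l2 H1 H2).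
Qed.

Section Integral.

Context {f : R -> C} {a b : R}.
Context (Hab : a <= b).
Context (Hf : forall t, a <= t <= b -> curve_continuous f t).

Lemma CInt_correct :
  is_RInt (fun t => fst (f t)) a b (fst (CInt f a b)) /\
  is_RInt (fun t => snd (f t)) a b (snd (CInt f a b)).
Proof.
  assert (E : ex_RInt (fun t => fst (f t)) a b /\ ex_RInt (fun t => snd (f t)) a b).
  { split; apply (ex_RInt_continuous (V := R_CompleteNormedModule)); intros t;
      rewrite Rmin_left, Rmax_right by exact Hab; intros Ht; apply Hf, Ht. }
  destruct E as [[l1 E1] [l2 E2]].
  rewrite (is_RInt_CInt f a b (l1, l2) E1 E2). split; assumption.
Qed.

Lemma CInt_is_RInt : is_RInt (V := C_R_NormedModule) f a b (CInt f a b).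
Proof.
  destruct CInt_correct as [H1 H2]. destruct (CInt f a b) as [l1 l2].
  apply (is_RInt_fct_extend_pair (U := R_NormedModule) (V := R_NormedModule) f a b l1 l2 H1 H2).
Qed.

(** A majorant depending on [t] is needed for the radial integral, whose integrand may blow up
    towards the boundary. *)
Lemma CInt_mod_le_integral (k : R -> R) (l : R) :
  (forall t, a <= t <= b -> Cmod (f t) <= k t) -> is_RInt k a b l -> Cmod (CInt f a b) <= l.
Proof.
  intros Hk Hl. rewrite Cmod_norm.
  apply (norm_RInt_le (V := C_R_NormedModule) f k a b); try assumption.
  - intros t Ht. apply Rle_trans with (2 := Hk t Ht). rewrite Cmod_norm. apply Rle_refl.
  - exact CInt_is_RInt.
Qed.

Lemma CInt_mod_le (M : R) :
  (forall t, a <= t <= b -> Cmod (f t) <= M) -> Cmod (CInt f a b) <= (b - a) * M.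
Proof.
  intros HM. apply (CInt_mod_le_integral (fun _ => M)); [exact HM|]. apply (is_RInt_const a b M).
Qed.

Lemma CInt_mult_r (c : C) : CInt (fun t => f t * c)%C a b = (CInt f a b * c)%C.
Proof.
  destruct CInt_correct as [H1 H2]. apply is_RInt_CInt; simpl.
  - evar_last; [eapply is_RInt_ext; [|apply (is_RInt_minus (V := R_NormedModule) _ _ _ _ _ _
      (is_RInt_scal _ _ _ (fst c) _ H1) (is_RInt_scal _ _ _ (snd c) _ H2))]|].
    + intros t _. unfold minus, plus, opp, scal; simpl. unfold mult; simpl. ring.
    + unfold minus, plus, opp, scal; simpl. unfold mult; simpl. ring.
  - evar_last; [eapply is_RInt_ext; [|apply (is_RInt_plus (V := R_NormedModule) _ _ _ _ _ _
      (is_RInt_scal _ _ _ (snd c) _ H1) (is_RInt_scal _ _ _ (fst c) _ H2))]|].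
    + intros t _. unfold minus, plus, opp, scal; simpl. unfold mult; simpl. ring.
    + unfold minus, plus, opp, scal; simpl. unfold mult; simpl. ring.
Qed.

End Integral.

Lemma CInt_minus (f g : R -> C) (a b : R) : a <= b ->
  (forall t, a <= t <= b -> curve_continuous f t) ->
  (forall t, a <= t <= b -> curve_continuous g t) ->
  CInt (fun t => f t - g t)%C a b = (CInt f a b - CInt g a b)%C.
Proof.
  intros Hab Hf Hg.
  apply (is_RInt_unique (V := C_R_CompleteNormedModule)). apply (is_RInt_minus (V := C_R_NormedModule)); apply CInt_is_RInt; assumption.
Qed.

Lemma CInt_ext (f g : R -> C) (a b : R) : a <= b ->
  (forall t, a <= t <= b -> f t = g t) -> CInt f a b = CInt g a b.
Proof.
  intros Hab H. apply (RInt_ext (V := C_R_CompleteNormedModule)). intros t. rewrite Rmin_left, Rmax_right by exact Hab.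
  intros Ht. apply H. lra.
Qed.

Lemma CInt_derive (F f : R -> C) (a b : R) : a <= b ->
  (forall t, a <= t <= b -> curve_derive F t (f t)) ->
  (forall t, a <= t <= b -> curve_continuous f t) ->
  CInt f a b = (F b - F a)%C.
Proof.
  intros Hab HF Hf. apply is_RInt_CInt.
  - apply (is_RInt_derive (V := R_CompleteNormedModule) (fun t => fst (F t)));
      intros t; rewrite Rmin_left, Rmax_right by exact Hab; intros Ht;
      [apply HF, Ht | apply Hf, Ht].
  - apply (is_RInt_derive (V := R_CompleteNormedModule) (fun t => snd (F t)));
      intros t; rewrite Rmin_left, Rmax_right by exact Hab; intros Ht;
      [apply HF, Ht | apply Hf, Ht].
Qed.

(** * Complex differentiability *)

Lemma Cdiff_cont (f : C -> C) (z l : C) : Cdiff f z l -> Ccont f z.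
Proof.
  intros H e He. destruct (H 1 Rlt_0_1) as [d [Hd K]].
  set (A := Cmod l + 1). assert (HA : 0 < A) by (pose proof (Cmod_ge_0 l); unfold A; lra).
  exists (Rmin d (e / A)). split; [apply Rmin_pos; [auto|apply Rdiv_lt_0_compat; auto]|].
  intros h Hh. specialize (K h (Rlt_le_trans _ _ _ Hh (Rmin_l _ _))).
  assert (Hh' := Rlt_le_trans _ _ _ Hh (Rmin_r _ _)).
  eapply Rle_lt_trans; [apply (Cmod_le_add_minus _ (l * h)%C)|].
  rewrite Cmod_mult. apply Rle_lt_trans with (A * Cmod h); [unfold A; lra|].
  apply Rmult_lt_compat_l with (r := A) in Hh'; [|exact HA].
  replace (A * (e / A)) with e in Hh' by (field; lra). exact Hh'.
Qed.

Lemma is_derive_Cdiff (f : C -> C) (z l : C) :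
  @is_derive C_AbsRing C_NormedModule f z l <-> Cdiff f z l.
Proof.
  split.
  - intros [_ H] e He. specialize (H z (fun P HP => HP) (mkposreal e He)).
    destruct H as [d Hd]. exists d. split; [apply cond_pos|]. intros h Hh.
    assert (Hb : ball (M := AbsRing_UniformSpace C_AbsRing) z d (z + h)%C).
    { unfold ball; simpl. unfold AbsRing_ball, abs, minus, plus, opp; simpl.
      replace (z + h + - z)%C with h by ring. exact Hh. }
    specialize (Hd _ Hb). unfold norm, minus, plus, opp, scal in Hd; simpl in Hd.
    unfold mult, plus, opp in Hd; simpl in Hd.
    replace (f (z + h) - f z - l * h)%C with (f (z + h) + - f z + - ((z + h + - z) * l))%C by ring.
    replace (z + h + - z)%C with h in * by ring. exact Hd.
  - intros H. split.
    + apply (is_linear_scal_l (K := C_AbsRing) (V := C_NormedModule)).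
    + intros x Hx e. apply (is_filter_lim_locally_unique (V := AbsRing_NormedModule C_AbsRing) z x) in Hx. subst x.
      destruct (H e (cond_pos e)) as [d [Hd K]].
      assert (A : forall y : C, Cmod (y - z) < d ->
          Cmod (f y + - f z + - ((y + - z) * l)) <= e * Cmod (y - z)).
      { intros y Hy. specialize (K (y - z)%C Hy). replace (z + (y - z))%C with y in K by ring.
        replace (f y + - f z + - ((y + - z) * l))%C with (f y - f z - l * (y - z))%C by ring.
        exact K. }
      exists (mkposreal d Hd). intros y Hy. exact (A y Hy).
Qed.

Lemma analytic_Cdiff (f : C -> C) :
  analytic f <-> forall z, disc z -> Cdiff f z (C_derive f z).
Proof.
  split.
  - intros H z Hz. apply is_derive_Cdiff, (C_derive_correct f z 0%C), H, Hz.
  - intros H z Hz. exists (C_derive f z). apply is_derive_Cdiff, H, Hz.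
Qed.

Lemma analytic_intro (f df : C -> C) : (forall z, disc z -> Cdiff f z (df z)) -> analytic f.
Proof. intros H z Hz. exists (df z). apply is_derive_Cdiff, H, Hz. Qed.

Lemma Cdiff_C_derive (f : C -> C) (z l : C) : Cdiff f z l -> C_derive f z = l.
Proof. intros H. apply is_C_derive_unique, is_derive_Cdiff, H. Qed.

Lemma Cdiff_minus (f g : C -> C) (z l m : C) :
  Cdiff f z l -> Cdiff g z m -> Cdiff (fun x => f x - g x)%C z (l - m)%C.
Proof.
  rewrite <- !is_derive_Cdiff. intros F G.
  apply (is_derive_minus (K := C_AbsRing) (V := C_NormedModule) f g z l m F G).
Qed.

Lemma Cdiff_mult (f g : C -> C) (z l m : C) :
  Cdiff f z l -> Cdiff g z m -> Cdiff (fun x => f x * g x)%C z (l * g z + f z * m)%C.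
Proof.
  intros F G e He. pose proof (Cdiff_cont _ _ _ G) as Gc.
  set (A := Cmod l + 1). set (B := Cmod (g z) + 1). set (D := Cmod (f z) + 1).
  assert (HA : 0 < A) by (pose proof (Cmod_ge_0 l); unfold A; lra).
  assert (HB : 0 < B) by (pose proof (Cmod_ge_0 (g z)); unfold B; lra).
  assert (HD : 0 < D) by (pose proof (Cmod_ge_0 (f z)); unfold D; lra).
  destruct (F 1 Rlt_0_1) as [d1 [Hd1 K1]].
  destruct (F (e / (3 * B))) as [d2 [Hd2 K2]]; [apply Rdiv_lt_0_compat; lra|].
  destruct (G (e / (3 * D))) as [d3 [Hd3 K3]]; [apply Rdiv_lt_0_compat; lra|].
  destruct (Gc (e / (3 * A))) as [d4 [Hd4 K4]]; [apply Rdiv_lt_0_compat; lra|].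
  exists (Rmin (Rmin d1 d2) (Rmin d3 d4)). split; [repeat apply Rmin_pos; auto|].
  intros h Hh.
  assert (Hh1 := Rlt_le_trans _ _ _ Hh (Rmin_l _ _)).
  assert (Hh2 := Rlt_le_trans _ _ _ Hh (Rmin_r _ _)).
  specialize (K1 h (Rlt_le_trans _ _ _ Hh1 (Rmin_l _ _))).
  specialize (K2 h (Rlt_le_trans _ _ _ Hh1 (Rmin_r _ _))).
  specialize (K3 h (Rlt_le_trans _ _ _ Hh2 (Rmin_l _ _))).
  specialize (K4 h (Rlt_le_trans _ _ _ Hh2 (Rmin_r _ _))).
  (* The remainder consists of the two linearisation errors and the product of the two increments,
     the latter being [O(|h|)] times something small; each receives a third of [e]. *)
  replace (f (z + h)%C * g (z + h)%C - f z * g z - (l * g z + f z * m) * h)%C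
    with ((f (z + h)%C - f z - l * h) * g z + f z * (g (z + h)%C - g z - m * h)
          + (f (z + h)%C - f z) * (g (z + h)%C - g z))%C by ring.
  eapply Rle_trans; [apply Cmod_triangle|].
  eapply Rle_trans; [apply Rplus_le_compat_r, Cmod_triangle|].
  rewrite !Cmod_mult.
  assert (L : Cmod (f (z + h)%C - f z) <= A * Cmod h).
  { eapply Rle_trans; [apply (Cmod_le_add_minus _ (l * h)%C)|].
    rewrite Cmod_mult. unfold A. lra. }
  assert (P1 : Cmod (f (z + h)%C - f z - l * h) * Cmod (g z) <= e / (3 * B) * Cmod h * B).
  { apply Rmult_le_compat; try apply Cmod_ge_0; [exact K2 | unfold B; lra]. }
  assert (P2 : Cmod (f z) * Cmod (g (z + h)%C - g z - m * h) <= D * (e / (3 * D) * Cmod h)).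
  { apply Rmult_le_compat; try apply Cmod_ge_0; [unfold D; lra | exact K3]. }
  assert (P3 : Cmod (f (z + h)%C - f z) * Cmod (g (z + h)%C - g z) <= A * Cmod h * (e / (3 * A))).
  { apply Rmult_le_compat; try apply Cmod_ge_0; [exact L | lra]. }
  replace (e / (3 * B) * Cmod h * B) with (e / 3 * Cmod h) in P1 by (field; lra).
  replace (D * (e / (3 * D) * Cmod h)) with (e / 3 * Cmod h) in P2 by (field; lra).
  replace (A * Cmod h * (e / (3 * A))) with (e / 3 * Cmod h) in P3 by (field; lra).
  lra.
Qed.

(** * Goursat's lemma and primitives *)

Definition segment (a b : C) (t : R) : C := (a + RtoC t * (b - a))%C.

Definition seg_int (h : C -> C) (a b : C) : C :=
  CInt (fun t => h (segment a b t) * (b - a))%C 0 1.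

Lemma segment_derive (a b : C) (t : R) : curve_derive (segment a b) t (b - a)%C.
Proof.
  eapply curve_derive_ext_value; [|apply curve_derive_plus; [apply curve_derive_const |
    apply curve_derive_mult; [apply curve_derive_RtoC | apply curve_derive_const]]].
  simpl. ring.
Qed.

Lemma segment_continuous (a b : C) (t : R) : curve_continuous (segment a b) t.
Proof. eapply curve_derive_continuous, segment_derive. Qed.

Lemma Cmod_segment_le (a b : C) (t M : R) :
  0 <= t <= 1 -> Cmod a <= M -> Cmod b <= M -> Cmod (segment a b t) <= M.
Proof.
  intros Ht Ha Hb. unfold segment.
  replace (a + RtoC t * (b - a))%C with (RtoC (1 - t) * a + RtoC t * b)%C
    by (rewrite RtoC_minus; ring).
  eapply Rle_trans; [apply Cmod_triangle|]. rewrite !Cmod_RtoC_mult by lra. nra.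
Qed.

Lemma disc_segment (a b : C) (t : R) : 0 <= t <= 1 -> disc a -> disc b -> disc (segment a b t).
Proof.
  intros Ht Ha Hb. unfold disc in *.
  apply Rle_lt_trans with (Rmax (Cmod a) (Cmod b)).
  - apply Cmod_segment_le; [exact Ht | apply Rmax_l | apply Rmax_r].
  - apply Rmax_lub_lt; assumption.
Qed.

Lemma segment_minus_start (a b : C) (t : R) : 0 <= t <= 1 ->
  Cmod (segment a b t - a) <= Cmod (b - a).
Proof.
  intros Ht. unfold segment. replace (a + RtoC t * (b - a) - a)%C with (RtoC t * (b - a))%C by ring.
  rewrite Cmod_RtoC_mult by lra. pose proof (Cmod_ge_0 (b - a)). nra.
Qed.

Lemma seg_integrand_continuous (h : C -> C) (a b : C) (t : R) :
  Ccont h (segment a b t) -> curve_continuous (fun t => h (segment a b t) * (b - a))%C t.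
Proof.
  intros H. apply curve_continuous_mult; [|apply curve_continuous_const].
  apply curve_continuous_comp; [apply segment_continuous | exact H].
Qed.

Lemma seg_int_derive (F f : C -> C) (a b : C) :
  (forall t, 0 <= t <= 1 -> Cdiff F (segment a b t) (f (segment a b t))) ->
  (forall t, 0 <= t <= 1 -> Ccont f (segment a b t)) ->
  seg_int f a b = (F b - F a)%C.
Proof.
  intros HF Hf. unfold seg_int.
  rewrite (CInt_derive (fun t => F (segment a b t))).
  - unfold segment. f_equal; [|f_equal]; f_equal; ring.
  - lra.
  - intros t Ht. apply curve_derive_comp; [apply segment_derive | apply HF, Ht].
  - intros t Ht. apply seg_integrand_continuous, Hf, Ht.
Qed.

Lemma seg_int_mod_le (h : C -> C) (a b : C) (M : R) :
  (forall t, 0 <= t <= 1 -> Ccont h (segment a b t)) ->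
  (forall t, 0 <= t <= 1 -> Cmod (h (segment a b t)) <= M) ->
  Cmod (seg_int h a b) <= M * Cmod (b - a).
Proof.
  intros Hc HM. unfold seg_int.
  replace (M * Cmod (b - a)) with ((1 - 0) * (M * Cmod (b - a))) by ring.
  apply CInt_mod_le; [lra | |].
  - intros t Ht. apply seg_integrand_continuous, Hc, Ht.
  - intros t Ht. rewrite Cmod_mult. apply Rmult_le_compat_r; [apply Cmod_ge_0 | apply HM, Ht].
Qed.

Lemma seg_int_minus (f h : C -> C) (a b : C) :
  (forall t, 0 <= t <= 1 -> Ccont f (segment a b t)) ->
  (forall t, 0 <= t <= 1 -> Ccont h (segment a b t)) ->
  seg_int (fun z => f z - h z)%C a b = (seg_int f a b - seg_int h a b)%C.
Proof.
  intros Hf Hh. unfold seg_int. rewrite <- CInt_minus.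
  - apply CInt_ext; [lra|]. intros t _. ring.
  - lra.
  - intros t Ht. apply seg_integrand_continuous, Hf, Ht.
  - intros t Ht. apply seg_integrand_continuous, Hh, Ht.
Qed.

Definition midpoint (a b : C) : C := (RtoC (/ 2) * (a + b))%C.

(** The [+ 0] keeps the shape [u * t + v] expected by [is_RInt_comp_lin], so both halves undergo the
    same kind of affine substitution. *)
Lemma segment_midpoint_l (a b : C) (t : R) :
  segment a (midpoint a b) t = segment a b (/ 2 * t + 0).
Proof. apply injective_projections; simpl; field. Qed.

Lemma segment_midpoint_r (a b : C) (t : R) :
  segment (midpoint a b) b t = segment a b (/ 2 * t + / 2).
Proof. apply injective_projections; simpl; field. Qed.

Lemma midpoint_minus_l (a b : C) : (midpoint a b - a = RtoC (/ 2) * (b - a))%C.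
Proof. apply injective_projections; simpl; field. Qed.

Lemma midpoint_minus_r (a b : C) : (b - midpoint a b = RtoC (/ 2) * (b - a))%C.
Proof. apply injective_projections; simpl; field. Qed.

Lemma seg_int_midpoint (h : C -> C) (a b : C) :
  (forall t, 0 <= t <= 1 -> Ccont h (segment a b t)) ->
  seg_int h a b = (seg_int h a (midpoint a b) + seg_int h (midpoint a b) b)%C.
Proof.
  intros Hc. set (phi := fun t => (h (segment a b t) * (b - a))%C).
  assert (HI : forall u v, 0 <= u -> u <= v -> v <= 1 ->
             is_RInt (V := C_R_NormedModule) phi u v (CInt phi u v)).
  { intros u v Hu Huv Hv. apply CInt_is_RInt; [exact Huv|]. intros t Ht.
    apply seg_integrand_continuous, Hc. lra. }
  assert (E1 : seg_int h a (midpoint a b) = CInt phi 0 (/ 2)).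
  { apply (is_RInt_unique (V := C_R_CompleteNormedModule)).
    assert (K : is_RInt (V := C_R_NormedModule) phi (/ 2 * 0 + 0) (/ 2 * 1 + 0) (CInt phi 0 (/ 2))).
    { replace (/ 2 * 0 + 0) with 0 by ring. replace (/ 2 * 1 + 0) with (/ 2) by ring.
      apply HI; lra. }
    apply is_RInt_comp_lin in K. eapply is_RInt_ext; [|exact K].
    intros t _. unfold phi. rewrite scal_R_Cmult, segment_midpoint_l, midpoint_minus_l.
    simpl. ring. }
  assert (E2 : seg_int h (midpoint a b) b = CInt phi (/ 2) 1).
  { apply (is_RInt_unique (V := C_R_CompleteNormedModule)).
    assert (K : is_RInt (V := C_R_NormedModule) phi (/ 2 * 0 + / 2) (/ 2 * 1 + / 2) (CInt phi (/ 2) 1)).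
    { replace (/ 2 * 0 + / 2) with (/ 2) by ring. replace (/ 2 * 1 + / 2) with 1 by field.
      apply HI; lra. }
    apply is_RInt_comp_lin in K. eapply is_RInt_ext; [|exact K].
    intros t _. unfold phi. rewrite scal_R_Cmult, segment_midpoint_r, midpoint_minus_r.
    simpl. ring. }
  rewrite E1, E2.
  apply (is_RInt_unique (V := C_R_CompleteNormedModule)).
  apply (is_RInt_Chasles (V := C_R_NormedModule)) with (/ 2); apply HI; lra.
Qed.

(** The boundary integral of a triangle; the return from [c] to [a] is entered as minus the integral
    from [a] to [c]. *)
Definition tri_int (h : C -> C) (a b c : C) : C :=
  (seg_int h a b + seg_int h b c - seg_int h a c)%C.

Definition perimeter (a b c : C) : R := Cmod (b - a) + Cmod (c - b) + Cmod (c - a).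

(* The middle triangle is oriented so that all three inner sides cancel
   without reversing a segment. *)
Lemma tri_int_subdivide (h : C -> C) (a b c : C) :
  (forall z, disc z -> Ccont h z) -> disc a -> disc b -> disc c ->
  let p := midpoint a b in let q := midpoint b c in let r := midpoint a c in
  tri_int h a b c =
  (tri_int h a p r + tri_int h p b q + tri_int h r q c - tri_int h p r q)%C.
Proof.
  intros Hc Ha Hb Hd p q r. unfold tri_int.
  rewrite (seg_int_midpoint h a b), (seg_int_midpoint h b c), (seg_int_midpoint h a c)
    by (intros t Ht; apply Hc, disc_segment; assumption).
  fold p q r. ring.
Qed.

(** Each side of a small triangle is either half of a side of the large one or a midline, hence half
    of the parallel side. *)
Lemma perimeter_halves (a b c : C) :
  let p := midpoint a b in let q := midpoint b c in let r := midpoint a c in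
  perimeter a p r = perimeter a b c / 2 /\ perimeter p b q = perimeter a b c / 2 /\
    perimeter r q c = perimeter a b c / 2 /\ perimeter p r q = perimeter a b c / 2.
Proof.
  intros p q r.
  assert (H : forall x y u v : C, (y - x = RtoC (/ 2) * (v - u))%C ->
            Cmod (y - x) = / 2 * Cmod (v - u)).
  { intros x y u v ->. apply Cmod_RtoC_mult. lra. }
  assert (H' : forall x y u v : C, (y - x = RtoC (/ 2) * (u - v))%C ->
            Cmod (y - x) = / 2 * Cmod (v - u)).
  { intros x y u v E. rewrite (Cmod_minus_sym v u). apply H, E. }
  unfold perimeter. repeat split.
  - rewrite (H a p a b), (H p r b c), (H a r a c);
      [field | | |]; apply injective_projections; simpl; field.
  - rewrite (H p b a b), (H b q b c), (H p q a c);
      [field | | |]; apply injective_projections; simpl; field.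
  - rewrite (H r q a b), (H q c b c), (H r c a c);
      [field | | |]; apply injective_projections; simpl; field.
  - rewrite (H p r b c), (H r q a b), (H p q a c);
      [field | | |]; apply injective_projections; simpl; field.
Qed.

Lemma perimeter_ge_sides (a b c : C) :
  Cmod (b - a) <= perimeter a b c /\ Cmod (c - a) <= perimeter a b c.
Proof.
  unfold perimeter. pose proof (Cmod_ge_0 (b - a)). pose proof (Cmod_ge_0 (c - a)).
  pose proof (Cmod_ge_0 (c - b)). lra.
Qed.

Record triangle : Type := Triangle { vert1 : C; vert2 : C; vert3 : C }.

Definition tint (h : C -> C) (T : triangle) : C := tri_int h (vert1 T) (vert2 T) (vert3 T).
Definition tper (T : triangle) : R := perimeter (vert1 T) (vert2 T) (vert3 T).
Definition tbound (M : R) (T : triangle) : Prop :=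
  Cmod (vert1 T) <= M /\ Cmod (vert2 T) <= M /\ Cmod (vert3 T) <= M.

Lemma Cmod_midpoint_le (a b : C) (M : R) :
  Cmod a <= M -> Cmod b <= M -> Cmod (midpoint a b) <= M.
Proof.
  intros Ha Hb. unfold midpoint. rewrite Cmod_RtoC_mult by lra.
  pose proof (Cmod_triangle a b). lra.
Qed.

(** One of the four pieces carries at least a quarter of the integral. The result is a sigma type so
    that the choice can be iterated by recursion; [tbound M] with [M < 1] keeps every triangle in
    one compact disc, so that the limit point stays in the open disc. *)
Lemma triangle_step (h : C -> C) (M : R) (T : triangle) :
  (forall z, disc z -> Ccont h z) -> M < 1 -> tbound M T ->
  { T' : triangle | tbound M T' /\ tper T' = tper T / 2 /\
        Cmod (tint h T) <= 4 * Cmod (tint h T') /\ Cmod (vert1 T' - vert1 T) <= tper T }.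
Proof.
  intros Hc HM HT. destruct T as [a b c].
  assert (HT' := HT). destruct HT' as [Ha [Hb Hd]]; simpl in *.
  pose proof (tri_int_subdivide h a b c Hc (Rle_lt_trans _ _ _ Ha HM) (Rle_lt_trans _ _ _ Hb HM)
    (Rle_lt_trans _ _ _ Hd HM)) as E.
  destruct (perimeter_halves a b c) as [P1 [P2 [P3 P4]]].
  destruct (perimeter_ge_sides a b c) as [S1 S2].
  assert (V1 : Cmod (midpoint a b - a) <= perimeter a b c).
  { rewrite midpoint_minus_l, Cmod_RtoC_mult by lra. pose proof (Cmod_ge_0 (b - a)). lra. }
  assert (V2 : Cmod (midpoint a c - a) <= perimeter a b c).
  { rewrite midpoint_minus_l, Cmod_RtoC_mult by lra. pose proof (Cmod_ge_0 (c - a)). lra. }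
  simpl in E, P1, P2, P3, P4.
  set (p := midpoint a b) in *. set (q := midpoint b c) in *. set (r := midpoint a c) in *.
  assert (Hp : Cmod p <= M) by (apply Cmod_midpoint_le; assumption).
  assert (Hq : Cmod q <= M) by (apply Cmod_midpoint_le; assumption).
  assert (Hr : Cmod r <= M) by (apply Cmod_midpoint_le; assumption).
  unfold tint, tper, tbound; simpl.
  destruct (Rle_lt_dec (Cmod (tri_int h a b c)) (4 * Cmod (tri_int h a p r))) as [L1|L1].
  { exists (Triangle a p r). simpl. repeat split; try assumption.
    replace (a - a)%C with (RtoC 0) by ring. rewrite Cmod_0.
    pose proof (Cmod_ge_0 (b - a)). lra. }
  destruct (Rle_lt_dec (Cmod (tri_int h a b c)) (4 * Cmod (tri_int h p b q))) as [L2|L2].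
  { exists (Triangle p b q). simpl. repeat split; assumption. }
  destruct (Rle_lt_dec (Cmod (tri_int h a b c)) (4 * Cmod (tri_int h r q c))) as [L3|L3].
  { exists (Triangle r q c). simpl. repeat split; assumption. }
  (* The other three pieces each fall strictly below a quarter, so by the triangle inequality this
     one must reach it. *)
  exists (Triangle p r q). simpl. repeat split; try assumption.
  pose proof (Cmod_triangle (tri_int h a p r + tri_int h p b q + tri_int h r q c)
    (- tri_int h p r q)) as D1. rewrite Cmod_opp in D1.
  pose proof (Cmod_triangle (tri_int h a p r + tri_int h p b q) (tri_int h r q c)) as D2.
  pose proof (Cmod_triangle (tri_int h a p r) (tri_int h p b q)) as D3.
  rewrite E in *. unfold Cminus in *. lra.
Qed.

(** Nested intervals: [2 * L * (/ 2) ^ n] is the sum of all increments from index [n] on, so the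
    intervals of that radius about [u n] decrease, and the supremum of their left ends lies in all
    of them. *)
Lemma geometric_limit (u : nat -> R) (L : R) :
  (forall n, Rabs (u (S n) - u n) <= L * (/ 2) ^ n) ->
  exists l, forall n, Rabs (u n - l) <= 2 * L * (/ 2) ^ n.
Proof.
  intros H.
  set (x := fun n => u n - 2 * L * (/ 2) ^ n). set (y := fun n => u n + 2 * L * (/ 2) ^ n).
  assert (Sx : forall n, x n <= x (S n)).
  { intros n. unfold x. specialize (H n). apply Rabs_le_between in H. simpl. lra. }
  assert (Sy : forall n, y (S n) <= y n).
  { intros n. unfold y. specialize (H n). apply Rabs_le_between in H. simpl. lra. }
  assert (Mx : forall n k, x n <= x (k + n)%nat).
  { intros n k. induction k; simpl; [lra|]. eapply Rle_trans; [exact IHk | apply Sx]. }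
  assert (My : forall n k, y (k + n)%nat <= y n).
  { intros n k. induction k; simpl; [lra|]. eapply Rle_trans; [apply Sy | exact IHk]. }
  assert (Hxy : forall n m, x n <= y m).
  { intros n m. apply Rle_trans with (x (m + n)%nat); [apply Mx|].
    apply Rle_trans with (y (m + n)%nat); [|replace (m + n)%nat with (n + m)%nat by lia; apply My].
    unfold x, y. pose proof (Rabs_pos (u (S (m + n)) - u (m + n)%nat)).
    specialize (H (m + n)%nat). lra. }
  destruct (completeness (fun r => exists n, r = x n)) as [l [Hl1 Hl2]].
  - exists (y O). intros r [n ->]. apply Hxy.
  - exists (x O), O. reflexivity.
  - exists l. intros n. apply Rabs_le_between.
    assert (A : x n <= l) by (apply Hl1; exists n; reflexivity).
    assert (B : l <= y n) by (apply Hl2; intros r [m ->]; apply Hxy).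
    unfold x in A. unfold y in B. lra.
Qed.

Lemma pow_half_small (K e : R) : 0 < e -> exists n, K * (/ 2) ^ n < e.
Proof.
  intros He. destruct (Rle_lt_dec K 0) as [HK|HK].
  - exists O. simpl. lra.
  - destruct (pow_lt_1_zero (/ 2)) with (y := e / K) as [n Hn].
    + rewrite Rabs_pos_eq; lra.
    + apply Rdiv_lt_0_compat; assumption.
    + exists n. specialize (Hn n (Nat.le_refl n)).
      rewrite Rabs_pos_eq in Hn by (apply pow_le; lra).
      apply Rmult_lt_compat_l with (r := K) in Hn; [|exact HK].
      replace (K * (e / K)) with e in Hn by (field; lra). exact Hn.
Qed.

Lemma Ccont_const (c z : C) : Ccont (fun _ => c) z.
Proof.
  intros e He. exists 1. split; [lra|]. intros u _.
  replace (c - c)%C with (RtoC 0) by ring. rewrite Cmod_0. exact He.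
Qed.

Lemma Ccont_minus (f h : C -> C) (z : C) :
  Ccont f z -> Ccont h z -> Ccont (fun x => f x - h x)%C z.
Proof.
  intros Hf Hh e He. destruct (Hf (e / 2)) as [d1 [Hd1 K1]]; [lra|].
  destruct (Hh (e / 2)) as [d2 [Hd2 K2]]; [lra|].
  exists (Rmin d1 d2). split; [apply Rmin_pos; auto|]. intros u Hu.
  specialize (K1 u (Rlt_le_trans _ _ _ Hu (Rmin_l _ _))).
  specialize (K2 u (Rlt_le_trans _ _ _ Hu (Rmin_r _ _))).
  replace (f (z + u)%C - h (z + u)%C - (f z - h z))%C
    with ((f (z + u)%C - f z) + - (h (z + u)%C - h z))%C by ring.
  eapply Rle_lt_trans; [apply Cmod_triangle|]. rewrite Cmod_opp. lra.
Qed.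

(** The affine part [k] has the primitive [K] and contributes nothing around a closed triangle, so
    only the remainder, bounded by [e] along the sides, is left to estimate. *)
Lemma tri_int_affine_remainder (h : C -> C) (a b c p l : C) (e : R) :
  (forall z, disc z -> Ccont h z) -> disc a -> disc b -> disc c ->
  (forall z, Cmod (z - a) <= perimeter a b c -> Cmod (h z - h p - l * (z - p)) <= e) ->
  Cmod (tri_int h a b c) <= e * perimeter a b c.
Proof.
  intros Hc Ha Hb Hd He.
  set (k := fun z => (h p + l * (z - p))%C).
  set (K := fun z => (h p * z + RtoC (/ 2) * l * ((z - p) * (z - p)))%C).
  assert (DK : forall z, Cdiff K z (k z)).
  { intros z eps Heps. exists (eps / (Cmod l + 1)).
    pose proof (Cmod_ge_0 l) as Hl. split; [apply Rdiv_lt_0_compat; lra|].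
    intros u Hu. replace (K (z + u)%C - K z - k z * u)%C with (RtoC (/ 2) * l * u * u)%C
      by (unfold K, k; apply injective_projections; simpl; field).
    rewrite !Cmod_mult, Cmod_R, (Rabs_pos_eq (/ 2)) by lra.
    apply Rmult_le_compat_r; [apply Cmod_ge_0|].
    apply Rmult_lt_compat_l with (r := Cmod l + 1) in Hu; [|lra].
    replace ((Cmod l + 1) * (eps / (Cmod l + 1))) with eps in Hu by (field; lra).
    pose proof (Cmod_ge_0 u). nra. }
  assert (Ck : forall z, Ccont k z).
  { intros z. apply (Cdiff_cont k z l). intros eps Heps. exists 1. split; [lra|].
    intros u _. replace (k (z + u)%C - k z - l * u)%C with (RtoC 0) by (unfold k; ring).
    rewrite Cmod_0. pose proof (Cmod_ge_0 u). nra. }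
  assert (Chk : forall z, disc z -> Ccont (fun z => h z - k z)%C z).
  { intros z Hz. apply Ccont_minus; [apply Hc, Hz | apply Ck]. }
  assert (D : forall x y, disc x -> disc y ->
    seg_int h x y = (seg_int (fun z => h z - k z)%C x y + (K y - K x))%C).
  { intros x y Hx Hy. rewrite <- (seg_int_derive K k x y).
    - rewrite seg_int_minus; [ring | |]; intros t Ht; [apply Hc, disc_segment; assumption | apply Ck].
    - intros t _. apply DK.
    - intros t _. apply Ck. }
  assert (E : tri_int h a b c = tri_int (fun z => h z - k z)%C a b c).
  { unfold tri_int. rewrite (D a b), (D b c), (D a c) by assumption. ring. }
  rewrite E. unfold tri_int, perimeter.
  destruct (perimeter_ge_sides a b c) as [S1 S2].
  assert (B : forall x y, disc x -> disc y ->
    (forall t, 0 <= t <= 1 -> Cmod (segment x y t - a) <= perimeter a b c) ->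
    Cmod (seg_int (fun z => h z - k z)%C x y) <= e * Cmod (y - x)).
  { intros x y Hx Hy Hxy. apply seg_int_mod_le.
    - intros t Ht. apply Chk, disc_segment; assumption.
    - intros t Ht. unfold k.
      replace (h (segment x y t) - (h p + l * (segment x y t - p)))%C
        with (h (segment x y t) - h p - l * (segment x y t - p))%C by ring.
      apply He, Hxy, Ht. }
  pose proof (B a b Ha Hb) as B1. pose proof (B b c Hb Hd) as B2. pose proof (B a c Ha Hd) as B3.
  assert (C1 : forall t, 0 <= t <= 1 -> Cmod (segment a b t - a) <= perimeter a b c).
  { intros t Ht. eapply Rle_trans; [apply segment_minus_start, Ht | exact S1]. }
  assert (C3 : forall t, 0 <= t <= 1 -> Cmod (segment a c t - a) <= perimeter a b c).
  { intros t Ht. eapply Rle_trans; [apply segment_minus_start, Ht | exact S2]. }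
  assert (C2 : forall t, 0 <= t <= 1 -> Cmod (segment b c t - a) <= perimeter a b c).
  { intros t Ht. eapply Rle_trans; [apply (Cmod_minus_triangle _ b)|].
    pose proof (segment_minus_start b c t Ht). unfold perimeter.
    pose proof (Cmod_ge_0 (c - a)). lra. }
  specialize (B1 C1). specialize (B2 C2). specialize (B3 C3).
  eapply Rle_trans; [apply Cmod_triangle|]. rewrite Cmod_opp.
  eapply Rle_trans; [apply Rplus_le_compat_r, Cmod_triangle|]. lra.
Qed.

Lemma goursat (h dh : C -> C) (a b c : C) :
  (forall z, disc z -> Cdiff h z (dh z)) -> disc a -> disc b -> disc c ->
  tri_int h a b c = 0%C.
Proof.
  intros Hh Ha Hb Hd.
  assert (Hc : forall z, disc z -> Ccont h z) by (intros z Hz; eapply Cdiff_cont, Hh, Hz).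
  set (M := Rmax (Cmod a) (Rmax (Cmod b) (Cmod c))).
  assert (HM : M < 1) by (repeat apply Rmax_lub_lt; assumption).
  set (T0 := Triangle a b c).
  assert (HT0 : tbound M T0).
  { unfold tbound, M; simpl. repeat split.
    - apply Rmax_l.
    - eapply Rle_trans; [|apply Rmax_r]. apply Rmax_l.
    - eapply Rle_trans; [|apply Rmax_r]. apply Rmax_r. }
  (* The recursion carries the proof of [tbound M] along, because [triangle_step] needs it as an
     input at every stage. *)
  set (next := fun T : {T | tbound M T} =>
    let s := triangle_step h M (proj1_sig T) Hc HM (proj2_sig T) in
    exist (tbound M) (proj1_sig s) (proj1 (proj2_sig s))).
  set (seq := fix seq n := match n with O => exist (tbound M) T0 HT0 | S n => next (seq n) end).
  set (T := fun n => proj1_sig (seq n)).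
  set (L := perimeter a b c).
  assert (HTb : forall n, tbound M (T n)) by (intros n; exact (proj2_sig (seq n))).
  assert (Hstep : forall n, tper (T (S n)) = tper (T n) / 2 /\
       Cmod (tint h (T n)) <= 4 * Cmod (tint h (T (S n))) /\
     Cmod (vert1 (T (S n)) - vert1 (T n)) <= tper (T n)).
  { intros n. exact (proj2 (proj2_sig (triangle_step h M (proj1_sig (seq n)) Hc HM (proj2_sig (seq n))))). }
  assert (Hper : forall n, tper (T n) = L * (/ 2) ^ n).
  { induction n; [unfold tper, T; simpl; fold L; ring|].
    rewrite (proj1 (Hstep n)), IHn. simpl. field. }
  assert (Hint : forall n, Cmod (tri_int h a b c) <= 4 ^ n * Cmod (tint h (T n))).
  { induction n; [unfold tint, T; simpl; lra|].
    eapply Rle_trans; [exact IHn|]. simpl. rewrite (Rmult_comm 4), Rmult_assoc.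
    apply Rmult_le_compat_l; [apply pow_le; lra | apply Hstep]. }
  assert (HL : 0 <= L).
  { unfold L, perimeter. pose proof (Cmod_ge_0 (b - a)). pose proof (Cmod_ge_0 (c - a)).
    pose proof (Cmod_ge_0 (c - b)). lra. }
  destruct (geometric_limit (fun n => fst (vert1 (T n))) L) as [p1 Hp1].
  { intros n. rewrite <- Hper. eapply Rle_trans; [|apply Hstep].
    apply (re_component_le_Cmod (vert1 (T (S n)) - vert1 (T n))). }
  destruct (geometric_limit (fun n => snd (vert1 (T n))) L) as [p2 Hp2].
  { intros n. rewrite <- Hper. eapply Rle_trans; [|apply Hstep].
    apply (im_component_le_Cmod (vert1 (T (S n)) - vert1 (T n))). }
  set (p := (p1, p2) : C).
  assert (Hp : forall n, Cmod (vert1 (T n) - p) <= 4 * L * (/ 2) ^ n).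
  { intros n. eapply Rle_trans; [apply Cmod_le_sum|]. specialize (Hp1 n). specialize (Hp2 n).
    simpl. unfold Rminus in *. lra. }
  assert (Dp : disc p).
  { apply Rle_lt_trans with (2 := HM). apply le_epsilon. intros e He.
    destruct (pow_half_small (4 * L) e He) as [n Hn].
    pose proof (Cmod_le_add_minus p (vert1 (T n))) as A. rewrite (Cmod_minus_sym p) in A.
    specialize (Hp n). destruct (HTb n) as [B _]. lra. }
  apply Cmod_eq_0_of_small. intros e He.
  (* With [x = (/ 2) ^ n], the sides of the n-th triangle lie within [5 * L * x] of [p]: [4 * L * x]
     for its first vertex and [L * x] for its perimeter. Its integral is thus at most
     [e' * (5 * L * x) * (L * x)], and the accumulated factor [4 ^ n] cancels [x * x]. The [+ 1]
     covers degenerate triangles with [L = 0]. *)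
  set (e' := e / (5 * L * L + 1)).
  assert (He' : 0 < e') by (apply Rdiv_lt_0_compat; nra).
  destruct (Hh p Dp e' He') as [d [Hd0 Kd]].
  destruct (pow_half_small (5 * L) d Hd0) as [n Hn].
  set (x := (/ 2) ^ n) in *. assert (Hx : 0 < x) by (apply pow_lt; lra).
  assert (A : Cmod (tint h (T n)) <= (e' * (5 * L * x)) * (L * x)).
  { unfold x. rewrite <- (Hper n). fold x. unfold tint, tper.
    destruct (HTb n) as [B1 [B2 B3]].
    apply (tri_int_affine_remainder h _ _ _ p (dh p)); try assumption;
      try (eapply Rle_lt_trans; eassumption).
    intros z Hz. fold (tper (T n)) in Hz. rewrite (Hper n) in Hz. fold x in Hz.
    assert (Hzp : Cmod (z - p) <= 5 * L * x).
    { eapply Rle_trans; [apply (Cmod_minus_triangle _ (vert1 (T n)))|].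
      specialize (Hp n). fold x in Hp. lra. }
    specialize (Kd (z - p)%C (Rle_lt_trans _ _ _ Hzp Hn)).
    replace (p + (z - p))%C with z in Kd by ring.
    eapply Rle_trans; [exact Kd|]. apply Rmult_le_compat_l; lra. }
  eapply Rle_trans; [apply (Hint n)|].
  apply Rle_trans with (4 ^ n * (e' * (5 * L * x) * (L * x))).
  { apply Rmult_le_compat_l; [apply pow_le; lra | exact A]. }
  assert (E4 : 4 ^ n * (x * x) = 1).
  { unfold x. rewrite <- !Rpow_mult_distr. replace (4 * (/ 2 * / 2)) with 1 by field. apply pow1. }
  replace (4 ^ n * (e' * (5 * L * x) * (L * x))) with (e' * (5 * L * L) * (4 ^ n * (x * x))) by ring.
  rewrite E4, Rmult_1_r.
  apply Rle_trans with (e' * (5 * L * L + 1)); [nra|]. right. unfold e'. field. nra.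
Qed.

Lemma integral_from_0_seg_int (h : C -> C) (z : C) : integral_from_0 h z = seg_int h 0 z.
Proof.
  apply (RInt_ext (V := C_R_CompleteNormedModule)). intros t _. unfold segment.
  replace (0 + RtoC t * (z - 0))%C with (RtoC t * z)%C by ring.
  replace (z - 0)%C with z by ring. reflexivity.
Qed.

Lemma disc_0 : disc 0%C.
Proof. unfold disc. rewrite Cmod_0. lra. Qed.

Lemma disc_near (z h : C) : Cmod h < 1 - Cmod z -> disc (z + h)%C.
Proof. intros H. unfold disc. pose proof (Cmod_triangle z h). lra. Qed.

Lemma analytic_cont (f : C -> C) (z : C) : analytic f -> disc z -> Ccont f z.
Proof. intros Hf Hz. rewrite analytic_Cdiff in Hf. eapply Cdiff_cont, Hf, Hz. Qed.

Lemma seg_int_near_const (f : C -> C) (a b c : C) (e : R) :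
  (forall t, 0 <= t <= 1 -> Ccont f (segment a b t)) ->
  (forall t, 0 <= t <= 1 -> Cmod (f (segment a b t) - c) <= e) ->
  Cmod (seg_int f a b - c * (b - a)) <= e * Cmod (b - a).
Proof.
  intros Hf He.
  assert (Ek : seg_int (fun _ => c) a b = (c * (b - a))%C).
  { rewrite (seg_int_derive (fun x => c * x)%C); [ring | |].
    - intros t _ eps Heps. exists 1. split; [lra|]. intros u _.
      match goal with |- Cmod ?x <= _ => replace x with (RtoC 0) by ring end.
      rewrite Cmod_0. pose proof (Cmod_ge_0 u). nra.
    - intros t _. apply Ccont_const. }
  rewrite <- Ek, <- seg_int_minus; [|exact Hf | intros; apply Ccont_const].
  apply seg_int_mod_le; [|exact He].
  intros t Ht. apply Ccont_minus; [apply Hf, Ht | apply Ccont_const].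
Qed.

Lemma segment_shift (z h : C) (t : R) : segment z (z + h) t = (z + RtoC t * h)%C.
Proof. unfold segment. ring. Qed.

(** By Goursat on the triangle [0], [z], [z + h], the increment of the radial integral is the
    integral of [f] over the segment from [z] to [z + h], where [f] is close to [f z]. *)
Lemma integral_from_0_Cdiff (f : C -> C) (z : C) :
  analytic f -> disc z -> Cdiff (integral_from_0 f) z (f z).
Proof.
  intros Hf Hz e He.
  assert (Hc : forall z, disc z -> Ccont f z) by (intros; apply analytic_cont; assumption).
  destruct (Hc z Hz e He) as [d [Hd K]].
  unfold disc in Hz. exists (Rmin d (1 - Cmod z)). split; [apply Rmin_pos; lra|].
  intros h Hh. assert (Hh1 := Rlt_le_trans _ _ _ Hh (Rmin_l _ _)).
  assert (Hzh : disc (z + h)%C) by (apply disc_near; apply (Rlt_le_trans _ _ _ Hh (Rmin_r _ _))).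
  rewrite !integral_from_0_seg_int.
  pose proof (goursat f (C_derive f) 0%C z (z + h)%C) as G. rewrite analytic_Cdiff in Hf.
  specialize (G Hf disc_0 Hz Hzh). unfold tri_int in G.
  replace (seg_int f 0 (z + h) - seg_int f 0 z - f z * h)%C
    with (seg_int f z (z + h) - f z * (z + h - z)
          - (seg_int f 0 z + seg_int f z (z + h) - seg_int f 0 (z + h)))%C by ring.
  rewrite G. replace (e * Cmod h) with (e * Cmod (z + h - z)) by (f_equal; f_equal; ring).
  match goal with |- Cmod (?x - RtoC 0) <= _ => replace (x - RtoC 0)%C with x by ring end.
  apply seg_int_near_const.
  - intros t Ht. apply Hc, disc_segment; assumption.
  - intros t Ht. rewrite segment_shift. left. apply K.
    rewrite Cmod_RtoC_mult by lra. pose proof (Cmod_ge_0 h). nra.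
Qed.

Lemma analytic_integral_from_0 (f : C -> C) : analytic f -> analytic (integral_from_0 f).
Proof. intros Hf. apply (analytic_intro _ f). intros z Hz. apply integral_from_0_Cdiff; assumption. Qed.

(** * Cauchy's formula for the derivative *)

Lemma closed_disc_uniform_continuity (phi : C -> C) (r e : R) :
  (forall z, disc z -> Ccont phi z) -> r < 1 -> 0 < e ->
  exists delta, 0 < delta /\
    forall z u, Cmod z <= r -> Cmod u < delta -> Cmod (phi (z + u)%C - phi z) < e.
Proof.
  intros Hphi Hr He.
  (* A gauge on the whole square. At a point of the closed disc it is a quarter of a continuity
     radius, which leaves room for the offset of the covering centre (below [2 * d]) plus the
     increment [u]. At a point outside it is so small that this point cannot serve as centre for any
     point of the closed disc. *)
  assert (D : forall x y : R, exists d : posreal,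
    (Cmod (x, y) <= r -> forall u, Cmod u < 4 * d -> Cmod (phi ((x, y) + u)%C - phi (x, y)) < e / 2)
    /\ (r < Cmod (x, y) -> 2 * d <= Cmod (x, y) - r)).
  { intros x y. destruct (Rle_lt_dec (Cmod (x, y)) r) as [L|L].
    - destruct (Hphi (x, y) (Rle_lt_trans _ _ _ L Hr) (e / 2)) as [d [Hd K]]; [lra|].
      assert (Hd4 : 0 < d / 4) by lra. exists (mkposreal _ Hd4). simpl. split; [|lra].
      intros _ u Hu. apply K. lra.
    - assert (Hd : 0 < (Cmod (x, y) - r) / 2) by lra.
      exists (mkposreal _ Hd). simpl. split; lra. }
  set (delta := fun x y => proj1_sig (constructive_indefinite_description _ (D x y))).
  assert (Hdelta : forall x y, _) by
    (intros x y; exact (proj2_sig (constructive_indefinite_description _ (D x y)))).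
  destruct (compactness_value_2d (-1) 1 (-1) 1 delta) as [d Hd].
  exists d. split; [apply cond_pos|]. intros z u Hz Hu.
  (* [compactness_value_2d] yields a covering centre only under a double negation, hence the
     argument by contradiction. *)
  destruct (Rlt_le_dec (Cmod (phi (z + u)%C - phi z)) e) as [L|L]; [exact L|exfalso].
  destruct z as [x y].
  apply (Hd x y).
  - apply Rabs_le_between. pose proof (re_component_le_Cmod (x, y)). simpl in *. lra.
  - apply Rabs_le_between. pose proof (im_component_le_Cmod (x, y)). simpl in *. lra.
  - intros [a [b [_ [_ [H1 [H2 H3]]]]]].
    destruct (Hdelta a b) as [K1 K2]. fold (delta a b) in K1, K2.
    set (w := ((x, y) - (a, b))%C).
    assert (Hw : Cmod w < 2 * delta a b).
    { eapply Rle_lt_trans; [apply Cmod_le_sum|]. simpl. unfold Rminus in *. lra. }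
    destruct (Rle_lt_dec (Cmod (a, b)) r) as [M|M].
    + specialize (K1 M). pose proof (cond_pos (delta a b)).
      assert (A : Cmod (phi (x, y) - phi (a, b)) < e / 2).
      { replace ((x, y) : C) with ((a, b) + w)%C by (unfold w; ring). apply K1. lra. }
      assert (B : Cmod (phi ((x, y) + u)%C - phi (a, b)) < e / 2).
      { replace ((x, y) + u)%C with ((a, b) + (w + u))%C by (unfold w; ring). apply K1.
        eapply Rle_lt_trans; [apply Cmod_triangle|]. lra. }
      pose proof (Cmod_minus_triangle (phi ((x, y) + u)%C) (phi (a, b)) (phi (x, y))) as T.
      rewrite (Cmod_minus_sym (phi (a, b))) in T. lra.
    + specialize (K2 M). pose proof (Cmod_le_add_minus (a, b) (x, y)) as T.
      rewrite (Cmod_minus_sym (a, b)) in T. fold w in T. lra.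
Qed.

(** A mean value inequality: the increment of [h] is the integral of [dh] along the segment. It
    turns uniform continuity of [dh] into a linearisation error uniform in [z]. *)
Lemma increment_le (h dh : C -> C) (z u : C) (e : R) :
  (forall x, disc x -> Cdiff h x (dh x)) -> (forall x, disc x -> Ccont dh x) ->
  disc z -> disc (z + u)%C ->
  (forall t, 0 <= t <= 1 -> Cmod (dh (z + RtoC t * u)%C - dh z) <= e) ->
  Cmod (h (z + u)%C - h z - dh z * u) <= e * Cmod u.
Proof.
  intros Hh Hdh Hz Hzu He.
  rewrite <- (seg_int_derive h dh z (z + u)%C).
  - replace (dh z * u)%C with (dh z * (z + u - z))%C by ring.
    replace (e * Cmod u) with (e * Cmod (z + u - z)) by (f_equal; f_equal; ring).
    apply seg_int_near_const.
    + intros t Ht. apply Hdh, disc_segment; assumption.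
    + intros t Ht. rewrite segment_shift. apply He, Ht.
  - intros t Ht. apply Hh, disc_segment; assumption.
  - intros t Ht. apply Hdh, disc_segment; assumption.
Qed.

(** The parameter moves the path in the direction [kap]. This covers both a varying radius ([kap] is
    [expi]) and a varying centre ([kap] is 1). All paths stay near the disc of radius [r < 1], on
    which [dh] is uniformly continuous, so the pointwise errors integrate. *)
Lemma Cdiff_under_CInt (h dh : C -> C) (gam kap om : R -> C) (a b r : R) (s : C) :
  (forall x, disc x -> Cdiff h x (dh x)) -> (forall x, disc x -> Ccont dh x) ->
  a < b -> r < 1 ->
  (forall t, curve_continuous gam t) -> (forall t, curve_continuous kap t) ->
  (forall t, curve_continuous om t) ->
  (forall t, Cmod (kap t) <= 1) -> (forall t, Cmod (om t) <= 1) ->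
  (forall t, Cmod (gam t + s * kap t) <= r) ->
  Cdiff (fun k => CInt (fun t => h (gam t + k * kap t)%C * om t)%C a b) s
    (CInt (fun t => dh (gam t + s * kap t)%C * (kap t * om t))%C a b).
Proof.
  intros Hh Hdh Hab Hr Cg Ck Co Mk Mo Mg e He.
  set (e' := e / (b - a)). assert (He' : 0 < e') by (apply Rdiv_lt_0_compat; lra).
  destruct (closed_disc_uniform_continuity dh r e' Hdh Hr He') as [d [Hd K]].
  exists (Rmin d (1 - r)). split; [apply Rmin_pos; lra|]. intros k Hk.
  assert (Hk1 := Rlt_le_trans _ _ _ Hk (Rmin_l _ _)).
  assert (Hk2 := Rlt_le_trans _ _ _ Hk (Rmin_r _ _)).
  assert (Mkk : forall t, Cmod (k * kap t) <= Cmod k).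
  { intros t. rewrite Cmod_mult. specialize (Mk t). pose proof (Cmod_ge_0 k). nra. }
  assert (D0 : forall t, disc (gam t + s * kap t)%C).
  { intros t. apply Rle_lt_trans with (2 := Hr), Mg. }
  assert (D1 : forall t, disc (gam t + s * kap t + k * kap t)%C).
  { intros t. apply disc_near. specialize (Mkk t). specialize (Mg t). lra. }
  assert (E1 : forall t, (gam t + (s + k) * kap t = gam t + s * kap t + k * kap t)%C)
    by (intros t; ring).
  assert (Cl : forall z t, curve_continuous (fun t => gam t + z * kap t)%C t).
  { intros z t. apply curve_continuous_plus; [apply Cg|].
    apply curve_continuous_mult; [apply curve_continuous_const | apply Ck]. }
  assert (C1 : forall t, curve_continuous (fun t => h (gam t + (s + k) * kap t)%C * om t)%C t).
  { intros t. apply curve_continuous_mult; [|apply Co].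
    apply curve_continuous_comp; [apply Cl|]. rewrite E1. eapply Cdiff_cont, Hh, D1. }
  assert (C2 : forall t, curve_continuous (fun t => h (gam t + s * kap t)%C * om t)%C t).
  { intros t. apply curve_continuous_mult; [|apply Co].
    apply curve_continuous_comp; [apply Cl|]. eapply Cdiff_cont, Hh, D0. }
  assert (C3 : forall t, curve_continuous (fun t => dh (gam t + s * kap t)%C * (kap t * om t))%C t).
  { intros t. apply curve_continuous_mult; [|apply curve_continuous_mult; [apply Ck | apply Co]].
    apply curve_continuous_comp; [apply Cl|]. apply Hdh, D0. }
  assert (C3' : forall t, curve_continuous (fun t => dh (gam t + s * kap t)%C * (kap t * om t) * k)%C t).
  { intros t. apply curve_continuous_mult; [apply C3 | apply curve_continuous_const]. }
  rewrite <- CInt_mult_r by (first [lra | intros; apply C3]).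
  rewrite <- !CInt_minus by
    (first [lra | intros; apply curve_continuous_minus; auto | auto]).
  replace (e * Cmod k) with ((b - a) * (e' * Cmod k)) by (unfold e'; field; lra).
  apply CInt_mod_le; [lra | |].
  - intros t _. repeat apply curve_continuous_minus; auto.
  - intros t _. rewrite E1.
    replace (h (gam t + s * kap t + k * kap t)%C * om t - h (gam t + s * kap t)%C * om t
        - dh (gam t + s * kap t)%C * (kap t * om t) * k)%C
      with ((h (gam t + s * kap t + k * kap t)%C - h (gam t + s * kap t)%C
        - dh (gam t + s * kap t)%C * (k * kap t)) * om t)%C by ring.
    rewrite Cmod_mult.
    assert (A : Cmod (h (gam t + s * kap t + k * kap t)%C - h (gam t + s * kap t)%C
        - dh (gam t + s * kap t)%C * (k * kap t)) <= e' * Cmod (k * kap t)).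
    { apply increment_le; auto. intros u Hu. left. apply K; [apply Mg|].
      rewrite Cmod_RtoC_mult by lra. specialize (Mkk t). pose proof (Cmod_ge_0 (k * kap t)). nra. }
    specialize (Mo t). pose proof (Cmod_ge_0 (om t)).
    pose proof (Cmod_ge_0 (h (gam t + s * kap t + k * kap t)%C - h (gam t + s * kap t)%C
        - dh (gam t + s * kap t)%C * (k * kap t))).
    assert (e' * Cmod (k * kap t) <= e' * Cmod k) by (apply Rmult_le_compat_l; [lra | apply Mkk]).
    nra.
Qed.

(** * Integrals over circles and Cauchy's formula *)

Definition expi (t : R) : C := (cos t, sin t).
Definition expmi (t : R) : C := (cos t, - sin t).

Lemma expi_expmi (t : R) : (expi t * expmi t = 1)%C.
Proof.
  apply injective_projections; simpl; [|ring].
  pose proof (sin2_cos2 t) as H. unfold Rsqr in H. lra.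
Qed.

Lemma Cmod_expi (t : R) : Cmod (expi t) = 1.
Proof.
  unfold Cmod, expi; simpl. replace (cos t * (cos t * 1) + sin t * (sin t * 1)) with 1;
    [apply sqrt_1|]. pose proof (sin2_cos2 t) as H. unfold Rsqr in H. lra.
Qed.

Lemma Cmod_expmi (t : R) : Cmod (expmi t) = 1.
Proof.
  unfold Cmod, expmi; simpl. replace (cos t * (cos t * 1) + - sin t * (- sin t * 1)) with 1;
    [apply sqrt_1|]. pose proof (sin2_cos2 t) as H. unfold Rsqr in H. lra.
Qed.

Lemma expi_derive (t : R) : curve_derive expi t (Ci * expi t)%C.
Proof. split; simpl; auto_derive; trivial; ring. Qed.

Lemma expmi_derive (t : R) : curve_derive expmi t (- Ci * expmi t)%C.
Proof. split; simpl; auto_derive; trivial; ring. Qed.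

Lemma expi_continuous (t : R) : curve_continuous expi t.
Proof. eapply curve_derive_continuous, expi_derive. Qed.

Lemma expmi_continuous (t : R) : curve_continuous expmi t.
Proof. eapply curve_derive_continuous, expmi_derive. Qed.

Lemma Cmod_circle (z : C) (rho t : R) : 0 <= rho ->
  Cmod (z + RtoC rho * expi t) <= Cmod z + rho.
Proof.
  intros Hr. eapply Rle_trans; [apply Cmod_triangle|].
  rewrite Cmod_RtoC_mult, Cmod_expi by exact Hr. lra.
Qed.

(** Up to the factor [i / rho], this is the contour integral of [h x / (x - z)^2] over the circle,
    so the value to expect is [2 * PI * rho] times the derivative of [h] at [z]. *)
Definition circle_int (h : C -> C) (z : C) (rho : R) : C :=
  CInt (fun t => h (z + RtoC rho * expi t)%C * expmi t)%C 0 (2 * PI).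

Lemma circle_integrand_continuous (h : C -> C) (z s : C) (t : R) :
  Ccont h (z + s * expi t)%C -> curve_continuous (fun t => h (z + s * expi t)%C) t.
Proof.
  intros H. apply curve_continuous_comp; [|exact H].
  apply curve_continuous_plus; [apply curve_continuous_const|].
  apply curve_continuous_mult; [apply curve_continuous_const | apply expi_continuous].
Qed.

(** Along the circle, [h e^(-it) - s h'] is the derivative in [t] of the periodic function
    [i e^(-it) h], so its integral over a full period vanishes. *)
Lemma circle_int_by_parts (h dh : C -> C) (z : C) (s : R) :
  (forall x, disc x -> Cdiff h x (dh x)) -> (forall x, disc x -> Ccont dh x) ->
  0 <= s -> Cmod z + s < 1 ->
  circle_int h z s = (CInt (fun t => dh (z + RtoC s * expi t)%C) 0 (2 * PI) * RtoC s)%C.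
Proof.
  intros Hh Hdh Hs Hzs. pose proof PI_RGT_0.
  assert (D : forall t, disc (z + RtoC s * expi t)%C).
  { intros t. eapply Rle_lt_trans; [apply Cmod_circle, Hs | exact Hzs]. }
  assert (C1 : forall t, curve_continuous (fun t => h (z + RtoC s * expi t)%C * expmi t)%C t).
  { intros t. apply curve_continuous_mult; [|apply expmi_continuous].
    apply circle_integrand_continuous. eapply Cdiff_cont, Hh, D. }
  assert (C2 : forall t, curve_continuous (fun t => dh (z + RtoC s * expi t)%C) t).
  { intros t. apply circle_integrand_continuous, Hdh, D. }
  assert (C3 : forall t, curve_continuous (fun t => dh (z + RtoC s * expi t)%C * RtoC s)%C t).
  { intros t. apply curve_continuous_mult; [apply C2 | apply curve_continuous_const]. }
  assert (E : CInt (fun t => h (z + RtoC s * expi t)%C * expmi t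
      - dh (z + RtoC s * expi t)%C * RtoC s)%C 0 (2 * PI) = 0%C).
  { rewrite (CInt_derive (fun t => h (z + RtoC s * expi t)%C * (Ci * expmi t))%C).
    - unfold expi, expmi. rewrite cos_2PI, sin_2PI, cos_0, sin_0. ring.
    - lra.
    - intros t _. eapply curve_derive_ext_value; [|apply curve_derive_mult;
        [apply (curve_derive_comp h (fun t => z + RtoC s * expi t)%C);
          [apply curve_derive_plus; [apply curve_derive_const | apply curve_derive_mult;
            [apply curve_derive_const | apply expi_derive]] | apply Hh, D]
        | apply curve_derive_mult; [apply curve_derive_const | apply expmi_derive]]].
      simpl.
      match goal with |- ?x = _ => transitivity
        (dh (z + RtoC s * expi t)%C * RtoC s * (expi t * expmi t) * (Ci * Ci)
         - h (z + RtoC s * expi t)%C * expmi t * (Ci * Ci))%C end; [ring|].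
      rewrite expi_expmi. replace (Ci * Ci)%C with (- (1))%C
        by (apply injective_projections; simpl; ring). ring.
    - intros t _. apply curve_continuous_minus; auto. }
  rewrite CInt_minus in E by (first [lra | auto]).
  rewrite CInt_mult_r in E by (first [lra | auto]).
  apply Ceq_minus. exact E.
Qed.

Lemma curve_derive_0_constant (f : R -> C) (a b : R) :
  a < b -> (forall t, a <= t <= b -> curve_derive f t 0%C) -> f a = f b.
Proof.
  intros Hab H. apply injective_projections.
  - apply (eq_is_derive (V := R_NormedModule) (fun t => fst (f t)) a b); [|exact Hab].
    intros t Ht. apply H, Ht.
  - apply (eq_is_derive (V := R_NormedModule) (fun t => snd (f t)) a b); [|exact Hab].
    intros t Ht. apply H, Ht.
Qed.

(* With [m s := circle_int h z s], integration by parts reads [m = s m'], so [m s / s]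
   is constant and equals its limit [m' 0] at [0]. *)
Lemma circle_int_C1 (h dh : C -> C) (z : C) (rho : R) :
  (forall x, disc x -> Cdiff h x (dh x)) -> (forall x, disc x -> Ccont dh x) ->
  0 < rho -> Cmod z + rho < 1 ->
  circle_int h z rho = (RtoC (2 * PI * rho) * dh z)%C.
Proof.
  intros Hh Hdh Hrho Hz. pose proof PI_RGT_0 as Hpi.
  set (m := fun k : C => CInt (fun t => h (z + k * expi t)%C * expmi t)%C 0 (2 * PI)).
  set (M := fun k : C => CInt (fun t => dh (z + k * expi t)%C) 0 (2 * PI)).
  (* The radius is made a complex variable so that [Cdiff_under_CInt] applies. The derivative it
     yields carries the factor [expi t * expmi t = 1], which is inserted by hand. *)
  assert (Dm : forall s, 0 <= s <= rho -> Cdiff m (RtoC s) (M (RtoC s))).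
  { intros s Hs. unfold M.
    rewrite (CInt_ext _ (fun t => dh (z + RtoC s * expi t)%C * (expi t * expmi t))%C).
    - apply (Cdiff_under_CInt h dh (fun _ => z) expi expmi 0 (2 * PI) (Cmod z + rho));
        try assumption; try lra.
      + intros t. apply curve_continuous_const.
      + apply expi_continuous.
      + apply expmi_continuous.
      + intros t. rewrite Cmod_expi. lra.
      + intros t. rewrite Cmod_expmi. lra.
      + intros t. eapply Rle_trans; [apply Cmod_circle|]; lra.
    - lra.
    - intros t _. rewrite expi_expmi. ring. }
  assert (Em : forall s, 0 <= s <= rho -> m (RtoC s) = (M (RtoC s) * RtoC s)%C).
  { intros s Hs. apply (circle_int_by_parts h dh z s); try assumption; lra. }
  assert (M0 : M (RtoC 0) = (RtoC (2 * PI) * dh z)%C).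
  { unfold M. rewrite (CInt_ext _ (fun _ => dh z)) by
      (first [lra | intros t _; f_equal; ring]).
    unfold CInt. rewrite (RInt_const (V := C_R_CompleteNormedModule)), scal_R_Cmult.
    f_equal. f_equal. ring. }
  set (n := fun s => (RtoC (/ s) * m (RtoC s))%C).
  assert (Hn : forall s, 0 < s <= rho -> n s = n rho).
  { intros s Hs. destruct (Req_dec s rho) as [->|Hne]; [reflexivity|].
    apply curve_derive_0_constant; [lra|]. intros t Ht.
    assert (Di : curve_derive (fun t => RtoC (/ t)) t (RtoC (- / (t * t)))).
    { split; simpl; [|apply (is_derive_const (K := R_AbsRing) (V := R_NormedModule))].
      auto_derive; [lra|]. field. lra. }
    eapply curve_derive_ext_value; [|apply curve_derive_mult; [exact Di |
      apply (curve_derive_comp m RtoC); [apply curve_derive_RtoC | apply Dm; lra]]].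
    simpl. rewrite Em by lra.
    replace (- / (t * t)) with (- (/ t * / t)) by (field; lra).
    rewrite RtoC_opp, RtoC_mult.
    assert (Et : (RtoC (/ t) * RtoC t = 1)%C) by (rewrite <- RtoC_mult; f_equal; field; lra).
    match goal with |- ?x = _ => transitivity
      (RtoC (/ t) * M (RtoC t) * (1 - RtoC (/ t) * RtoC t))%C end; [ring|].
    rewrite Et. ring. }
  assert (Key : (n rho - M (RtoC 0))%C = 0%C).
  { apply Cmod_eq_0_of_small. intros e He.
    assert (R0 : 0 <= 0 <= rho) by lra.
    destruct (Dm 0 R0 e He) as [d [Hd K]].
    set (s := Rmin rho (d / 2)).
    assert (Hs : 0 < s) by (apply Rmin_pos; lra).
    assert (Hs1 : s <= rho) by apply Rmin_l.
    assert (Hs2 : s <= d / 2) by apply Rmin_r.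
    specialize (K (RtoC s)). rewrite Cmod_R, Rabs_pos_eq in K by lra.
    specialize (K ltac:(lra)).
    replace (RtoC 0 + RtoC s)%C with (RtoC s) in K by ring.
    rewrite (Em 0 R0) in K.
    rewrite <- (Hn s) by lra. unfold n.
    replace (RtoC (/ s) * m (RtoC s) - M (RtoC 0))%C
      with (RtoC (/ s) * (m (RtoC s) - M (RtoC 0) * RtoC 0 - M (RtoC 0) * RtoC s))%C.
    - assert (0 < / s) by (apply Rinv_0_lt_compat; lra).
      rewrite Cmod_RtoC_mult by lra.
      apply Rle_trans with (/ s * (e * s)); [apply Rmult_le_compat_l; lra|].
      right. field. lra.
    - assert (Es : (RtoC (/ s) * RtoC s = 1)%C) by (rewrite <- RtoC_mult; f_equal; field; lra).
      match goal with |- ?x = _ => transitivity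
        (RtoC (/ s) * m (RtoC s) - M (RtoC 0) * (RtoC (/ s) * RtoC s))%C end; [ring|].
      rewrite Es. ring. }
  apply Ceq_minus in Key.
  change (circle_int h z rho) with (m (RtoC rho)).
  assert (Er : (RtoC rho * RtoC (/ rho) = 1)%C) by (rewrite <- RtoC_mult; f_equal; field; lra).
  replace (m (RtoC rho)) with (RtoC rho * RtoC (/ rho) * m (RtoC rho))%C by (rewrite Er; ring).
  rewrite <- Cmult_assoc. fold (n rho). rewrite Key, M0, (RtoC_mult (2 * PI)). ring.
Qed.

(** If [k] is a circle integral of [H] with fixed radius, differentiating in the centre puts the
    derivative [h] of [H] under the integral. It is applied with [H] a primitive of [f] and
    [h = k = f], giving Cauchy's formula, and with [H = f] and [h = k = C_derive f], giving a second
    derivative. *)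
Lemma Cdiff_of_circle_rep (H h k : C -> C) (z : C) (rho : R) :
  (forall x, disc x -> Cdiff H x (h x)) -> (forall x, disc x -> Ccont h x) ->
  0 < rho -> Cmod z + rho < 1 ->
  (forall x, Cmod x + rho < 1 -> circle_int H x rho = (RtoC (2 * PI * rho) * k x)%C) ->
  Cdiff k z (RtoC (/ (2 * PI * rho)) * circle_int h z rho)%C.
Proof.
  intros HH Hh Hrho Hz Hk. pose proof PI_RGT_0 as Hpi.
  assert (Hc : 0 < 2 * PI * rho) by nra.
  assert (Hc' : 0 < / (2 * PI * rho)) by (apply Rinv_0_lt_compat; lra).
  assert (D : Cdiff (fun u => circle_int H (z + u)%C rho) 0%C (circle_int h z rho)).
  (* Moving the centre by [u] is the deformation [gam + u * kap] with [gam] the original circle and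
     [kap = 1]. *)
  { assert (E : forall u t, (z + u + RtoC rho * expi t = z + RtoC rho * expi t + u * 1)%C)
      by (intros; ring).
    unfold circle_int.
    rewrite (CInt_ext _ (fun t => h (z + RtoC rho * expi t + 0 * 1)%C * (1 * expmi t))%C).
    - intros e He.
      destruct (Cdiff_under_CInt H h (fun t => z + RtoC rho * expi t)%C (fun _ => 1%C) expmi
        0 (2 * PI) (Cmod z + rho) 0%C) with (eps := e) as [d [Hd K]]; try assumption; try lra.
      + intros t. apply curve_continuous_plus; [apply curve_continuous_const|].
        apply curve_continuous_mult; [apply curve_continuous_const | apply expi_continuous].
      + intros t. apply curve_continuous_const.
      + apply expmi_continuous.
      + intros t. rewrite Cmod_1. lra.
      + intros t. rewrite Cmod_expmi. lra.
      + intros t. rewrite <- E. replace (z + 0)%C with z by ring. apply Cmod_circle. lra.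
      + exists d. split; [exact Hd|]. intros u Hu. specialize (K u Hu).
        rewrite (CInt_ext (fun t => H (z + (0 + u) + RtoC rho * expi t)%C * expmi t)%C
          (fun t => H (z + RtoC rho * expi t + (0 + u) * 1)%C * expmi t)%C)
          by (first [lra | intros; rewrite E; reflexivity]).
        rewrite (CInt_ext (fun t => H (z + 0 + RtoC rho * expi t)%C * expmi t)%C
          (fun t => H (z + RtoC rho * expi t + 0 * 1)%C * expmi t)%C)
          by (first [lra | intros; rewrite E; reflexivity]).
        exact K.
    - lra.
    - intros t _. replace (z + RtoC rho * expi t + 0 * 1)%C with (z + RtoC rho * expi t)%C by ring.
      ring. }
  intros e He. destruct (D (e * (2 * PI * rho))) as [d [Hd K]]; [nra|].
  exists (Rmin d (1 - (Cmod z + rho))). split; [apply Rmin_pos; lra|]. intros u Hu.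
  specialize (K u (Rlt_le_trans _ _ _ Hu (Rmin_l _ _))).
  assert (Hu2 := Rlt_le_trans _ _ _ Hu (Rmin_r _ _)).
  replace (0 + u)%C with u in K by ring. replace (z + 0)%C with z in K by ring.
  rewrite (Hk (z + u)%C), (Hk z) in K;
    [| exact Hz | pose proof (Cmod_triangle z u); lra].
  set (c := 2 * PI * rho) in *.
  assert (Ec : (RtoC (/ c) * RtoC c = 1)%C) by (rewrite <- RtoC_mult; f_equal; field; lra).
  replace (k (z + u)%C - k z - RtoC (/ c) * circle_int h z rho * u)%C
    with (RtoC (/ c) * (RtoC c * k (z + u)%C - RtoC c * k z - circle_int h z rho * u))%C.
  - rewrite Cmod_RtoC_mult by lra.
    apply Rle_trans with (/ c * (e * c * Cmod u)); [apply Rmult_le_compat_l; lra|].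
    right. field. lra.
  - match goal with |- ?x = _ => transitivity
      ((RtoC (/ c) * RtoC c) * (k (z + u)%C - k z) - RtoC (/ c) * circle_int h z rho * u)%C end;
      [ring|].
    rewrite Ec. ring.
Qed.

Lemma cauchy_derivative_formula (f : C -> C) (z : C) (rho : R) :
  analytic f -> 0 < rho -> Cmod z + rho < 1 ->
  circle_int f z rho = (RtoC (2 * PI * rho) * C_derive f z)%C.
Proof.
  intros Hf Hrho Hz. pose proof PI_RGT_0 as Hpi.
  assert (Hc : 0 < 2 * PI * rho) by nra.
  assert (D : Cdiff f z (RtoC (/ (2 * PI * rho)) * circle_int f z rho)%C).
  { apply (Cdiff_of_circle_rep (integral_from_0 f) f f); try assumption.
    - intros x Hx. apply integral_from_0_Cdiff; assumption.
    - intros x Hx. apply analytic_cont; assumption.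
    - intros x Hx. apply circle_int_C1; try assumption.
      + intros y Hy. apply integral_from_0_Cdiff; assumption.
      + intros y Hy. apply analytic_cont; assumption. }
  rewrite (Cdiff_C_derive _ _ _ D), Cmult_assoc, <- RtoC_mult.
  replace (2 * PI * rho * / (2 * PI * rho)) with 1 by (field; lra). ring.
Qed.

Lemma circle_int_mod_le (h : C -> C) (z : C) (rho M : R) :
  (forall x, disc x -> Ccont h x) -> 0 <= rho -> Cmod z + rho < 1 ->
  (forall t, Cmod (h (z + RtoC rho * expi t)%C) <= M) ->
  Cmod (circle_int h z rho) <= 2 * PI * M.
Proof.
  intros Hh Hrho Hz HM. pose proof PI_RGT_0 as Hpi. unfold circle_int.
  replace (2 * PI * M) with ((2 * PI - 0) * M) by ring.
  apply CInt_mod_le; [lra | |].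
  - intros t _. apply curve_continuous_mult; [|apply expmi_continuous].
    apply circle_integrand_continuous, Hh.
    eapply Rle_lt_trans; [apply Cmod_circle, Hrho | exact Hz].
  - intros t _. rewrite Cmod_mult, Cmod_expmi, Rmult_1_r. apply HM.
Qed.

(** * Cauchy's estimate, regularity of the derivative, and boundedness on compact discs *)

Lemma cauchy_estimate (f : C -> C) (z : C) (rho M : R) :
  analytic f -> 0 < rho -> Cmod z + rho < 1 ->
  (forall x, Cmod (x - z) = rho -> Cmod (f x) <= M) ->
  Cmod (C_derive f z) <= M / rho.
Proof.
  intros Hf Hrho Hz HM. pose proof PI_RGT_0 as Hpi.
  assert (A : Cmod (circle_int f z rho) <= 2 * PI * M).
  { apply circle_int_mod_le; try assumption; [|lra|].
    - intros x Hx. apply analytic_cont; assumption.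
    - intros t. apply HM. replace (z + RtoC rho * expi t - z)%C with (RtoC rho * expi t)%C by ring.
      rewrite Cmod_RtoC_mult, Cmod_expi; lra. }
  rewrite (cauchy_derivative_formula f z rho Hf Hrho Hz), Cmod_RtoC_mult in A by nra.
  apply Rmult_le_reg_l with (2 * PI * rho); [nra|].
  eapply Rle_trans; [exact A|]. right. field. lra.
Qed.

(** Cauchy's formula with the same radius at [z] and at [z + u] expresses the difference of
    derivatives through differences of [f], which are uniformly small. *)
Lemma derivative_cont (f : C -> C) (z : C) : analytic f -> disc z -> Ccont (C_derive f) z.
Proof.
  intros Hf Hz e He. unfold disc in Hz. pose proof PI_RGT_0 as Hpi.
  set (rho := (1 - Cmod z) / 2). assert (Hrho : 0 < rho) by (unfold rho; lra).
  assert (Hzr : Cmod z + rho < 1) by (unfold rho; lra).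
  assert (Hc : forall x, disc x -> Ccont f x) by (intros; apply analytic_cont; assumption).
  (* The tolerance is chosen so that integrating over length [2 * PI] and dividing by [2 * PI * rho]
     leaves [e / 2]. *)
  destruct (closed_disc_uniform_continuity f (Cmod z + rho) (rho * e / 2) Hc Hzr) as [d [Hd K]];
    [nra|].
  exists (Rmin d (1 - (Cmod z + rho))). split; [apply Rmin_pos; lra|]. intros u Hu.
  assert (Hu1 := Rlt_le_trans _ _ _ Hu (Rmin_l _ _)).
  assert (Hu2 := Rlt_le_trans _ _ _ Hu (Rmin_r _ _)).
  assert (Hzu : Cmod (z + u) + rho < 1) by (pose proof (Cmod_triangle z u); lra).
  assert (D0 : forall t, disc (z + RtoC rho * expi t)%C).
  { intros t. eapply Rle_lt_trans; [apply Cmod_circle; lra | exact Hzr]. }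
  assert (D1 : forall t, disc (z + u + RtoC rho * expi t)%C).
  { intros t. eapply Rle_lt_trans; [apply Cmod_circle; lra | exact Hzu]. }
  assert (Cc : forall x t, (forall t, disc (x + RtoC rho * expi t)%C) ->
    curve_continuous (fun t => f (x + RtoC rho * expi t)%C * expmi t)%C t).
  { intros x t Hx. apply curve_continuous_mult; [|apply expmi_continuous].
    apply circle_integrand_continuous, Hc, Hx. }
  assert (A : Cmod (circle_int f (z + u)%C rho - circle_int f z rho) <= (2 * PI - 0) * (rho * e / 2)).
  { unfold circle_int. rewrite <- CInt_minus by (first [lra | intros; apply Cc; assumption]).
    apply CInt_mod_le; [lra | |].
    - intros t _. apply curve_continuous_minus; apply Cc; assumption.
    - intros t _.
      replace (f (z + u + RtoC rho * expi t)%C * expmi t - f (z + RtoC rho * expi t)%C * expmi t)%C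
        with ((f (z + RtoC rho * expi t + u)%C - f (z + RtoC rho * expi t)%C) * expmi t)%C
        by (replace (z + RtoC rho * expi t + u)%C with (z + u + RtoC rho * expi t)%C by ring; ring).
      rewrite Cmod_mult, Cmod_expmi, Rmult_1_r. left. apply K; [apply Cmod_circle; lra | exact Hu1]. }
  rewrite (cauchy_derivative_formula f z), (cauchy_derivative_formula f (z + u)%C) in A by assumption.
  replace (RtoC (2 * PI * rho) * C_derive f (z + u)%C - RtoC (2 * PI * rho) * C_derive f z)%C
    with (RtoC (2 * PI * rho) * (C_derive f (z + u)%C - C_derive f z))%C in A by ring.
  rewrite Cmod_RtoC_mult in A by nra.
  assert (Hp : 0 < 2 * PI * rho) by nra.
  apply Rle_lt_trans with (e / 2); [|lra].
  apply Rmult_le_reg_l with (2 * PI * rho); [exact Hp|]. lra.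
Qed.

Lemma analytic_derivative (f : C -> C) : analytic f -> analytic (C_derive f).
Proof.
  intros Hf.
  apply (analytic_intro _ (fun z => RtoC (/ (2 * PI * ((1 - Cmod z) / 2)))
    * circle_int (C_derive f) z ((1 - Cmod z) / 2))%C).
  intros z Hz. unfold disc in Hz.
  apply (Cdiff_of_circle_rep f (C_derive f)); try lra.
  - apply analytic_Cdiff, Hf.
  - intros x Hx. apply derivative_cont; assumption.
  - intros x Hx. apply cauchy_derivative_formula; [exact Hf | lra | exact Hx].
Qed.

(** Walk from 0 to [z] along the radius in equal steps shorter than the modulus of continuity for
    tolerance 1: each step adds at most 1 to [Cmod (f _)]. *)
Lemma bounded_on_closed_disc (f : C -> C) (r : R) :
  analytic f -> r < 1 ->
  exists M, 0 <= M /\ forall z, Cmod z <= r -> Cmod (f z) <= M.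
Proof.
  intros Hf Hr.
  destruct (closed_disc_uniform_continuity f r 1) as [d [Hd K]];
    [intros z Hz; apply analytic_cont; assumption | exact Hr | lra |].
  (* [n + 1] steps suffice: [/ d < n + 1] and [Cmod z < 1] make each of them shorter than [d]. *)
  destruct (nfloor_ex (/ d)) as [n [_ Hn]]; [left; apply Rinv_0_lt_compat, Hd|].
  assert (Hn0 : 0 < INR n + 1) by (pose proof (pos_INR n); lra).
  exists (Cmod (f (RtoC 0)) + (INR n + 1)). split; [pose proof (Cmod_ge_0 (f (RtoC 0))); lra|].
  intros z Hz.
  assert (W : forall k, INR k <= INR n + 1 ->
    Cmod (f (RtoC (INR k / (INR n + 1)) * z)%C) <= Cmod (f (RtoC 0)) + INR k).
  { induction k as [|k IH].
    - intros _. simpl. replace (RtoC (0 / (INR n + 1)) * z)%C with (RtoC 0); [lra|].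
      unfold Rdiv. rewrite Rmult_0_l. ring.
    - rewrite S_INR. intros Hk. specialize (IH ltac:(lra)). pose proof (pos_INR k) as Hk0.
      assert (Q : 0 <= INR k / (INR n + 1) <= 1).
      { split; [apply Rdiv_le_0_compat; lra|]. apply Rle_div_l; lra. }
      set (x := (RtoC (INR k / (INR n + 1)) * z)%C) in *.
      set (u := (RtoC (/ (INR n + 1)) * z)%C).
      replace (RtoC ((INR k + 1) / (INR n + 1)) * z)%C with (x + u)%C.
      + pose proof (Cmod_ge_0 z) as Hz0.
        assert (Hx : Cmod x <= r) by (unfold x; rewrite Cmod_RtoC_mult by lra; nra).
        assert (Hi : 0 < / (INR n + 1)) by (apply Rinv_0_lt_compat; lra).
        assert (Hid : / (INR n + 1) < d).
        { rewrite <- (Rinv_inv d). apply Rinv_lt_contravar; [|exact Hn].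
          apply Rmult_lt_0_compat; [apply Rinv_0_lt_compat, Hd | exact Hn0]. }
        assert (Hu : Cmod u < d) by (unfold u; rewrite Cmod_RtoC_mult by lra; nra).
        specialize (K x u Hx Hu). pose proof (Cmod_le_add_minus (f (x + u)%C) (f x)). lra.
      + unfold x, u. rewrite <- Cmult_plus_distr_r, <- RtoC_plus. f_equal. f_equal. field. lra. }
  specialize (W (S n)). rewrite S_INR in W. specialize (W ltac:(lra)).
  replace ((INR n + 1) / (INR n + 1)) with 1 in W by (field; lra).
  rewrite Cmult_1_l in W. exact W.
Qed.

(** * Growth of weights *)

(** Estimates are carried out with explicit real bounds; the extended-real supremum enters only
    through [sup_norm_finite] and [sup_norm_le]. *)
Definition weighted_bound (v : R -> R) (f : C -> C) (N : R) : Prop :=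
  forall z, disc z -> Cmod (f z) * v (Cmod z) <= N.

(** Passing from [r] to [(1 + r) / 2] halves [1 - r], so the increasing quotient costs exactly the
    factor [2^alpha]. Any [s] in between is covered because [v] is non-increasing. *)
Lemma weight_half_step (v : R -> R) :
  weight v -> eventually_increasing_quotient v ->
  exists K, 0 < K /\ forall r s, 0 <= r -> r <= s -> s <= (1 + r) / 2 -> r < 1 -> v r <= K * v s.
Proof.
  intros [_ [Hpos Hmon]] [alpha [r0 [Ha [Hr0 Hinc]]]].
  set (P := Rpower 2 alpha). assert (HP : 1 <= P).
  { unfold P. rewrite <- (Rpower_O 2) by lra. apply Rle_Rpower; lra. }
  assert (Hv0 : 0 < v r0) by (apply Hpos; unfold unit_interval; lra).
  assert (Hv00 : v r0 <= v 0) by (apply Hmon; unfold unit_interval; lra).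
  assert (Step : forall r, r0 <= r -> r < 1 -> v r <= P * v ((1 + r) / 2)).
  { intros r Hr Hr1. specialize (Hinc r ((1 + r) / 2) Hr ltac:(lra) ltac:(lra)).
    replace (1 - (1 + r) / 2) with ((1 - r) * / 2) in Hinc by field.
    rewrite <- Rpower_mult_distr in Hinc by lra.
    assert (E : Rpower (/ 2) (- alpha) = P).
    { unfold P, Rpower. rewrite ln_Rinv by lra. f_equal. ring. }
    rewrite E in Hinc.
    assert (Hq : 0 < Rpower (1 - r) (- alpha)) by apply exp_pos.
    apply Rmult_le_reg_r with (1 := Hq). lra. }
  (* The extra factor handles [r < r0], where [v r] is compared with [v 0] and the half step is
     taken from [r0] instead. *)
  exists (P * (v 0 / v r0)).
  assert (Hq : 1 <= v 0 / v r0) by (apply Rle_div_r; lra).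
  split; [nra|]. intros r s Hr Hrs Hs Hr1.
  assert (Hvs : v ((1 + r) / 2) <= v s) by (apply Hmon; unfold unit_interval; lra).
  assert (Hvp : 0 < v ((1 + r) / 2)) by (apply Hpos; unfold unit_interval; lra).
  destruct (Rle_lt_dec r0 r) as [L|L].
  - eapply Rle_trans; [apply Step; lra|].
    apply Rmult_le_compat; [lra | lra | | exact Hvs].
    rewrite <- (Rmult_1_r P) at 1. apply Rmult_le_compat_l; lra.
  - specialize (Step r0 (Rle_refl r0) (proj2 Hr0)).
    assert (A : v ((1 + r0) / 2) <= v ((1 + r) / 2)) by (apply Hmon; unfold unit_interval; lra).
    assert (B : v r <= v 0) by (apply Hmon; unfold unit_interval; lra).
    apply Rle_trans with (1 := B).
    replace (v 0) with (v 0 / v r0 * v r0) at 1 by (field; lra).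
    replace (P * (v 0 / v r0) * v s) with (v 0 / v r0 * (P * v s)) by ring.
    apply Rmult_le_compat_l; [lra|]. apply Rle_trans with (1 := Step).
    apply Rmult_le_compat_l; lra.
Qed.

(** On [[0, r0]] the power [(1 - t)^(-alpha)] lies between 1 and its value at [r0], while [v] is
    non-increasing. That value is therefore a sufficient price for extending the comparison to all
    of [[0, 1)]. *)
Lemma weight_decreasing_quotient (v : R -> R) :
  weight v -> eventually_decreasing_quotient v ->
  exists alpha K, 0 < alpha /\ 0 < K /\ forall t r, 0 <= t -> t <= r -> r < 1 ->
    v r * Rpower (1 - r) (- alpha) <= K * (v t * Rpower (1 - t) (- alpha)).
Proof.
  intros [_ [Hpos Hmon]] [alpha [r0 [Ha [Hr0 Hdec]]]].
  assert (Anti : forall x y, 0 < x -> x <= y -> Rpower y (- alpha) <= Rpower x (- alpha)).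
  { intros x y Hx Hxy. rewrite !Rpower_Ropp. apply Rinv_le_contravar; [apply exp_pos|].
    apply Rle_Rpower_l; lra. }
  assert (One : forall x, 0 < x -> x <= 1 -> 1 <= Rpower x (- alpha)).
  { intros x Hx Hx1. rewrite <- (Rpower_1 1) at 1 by lra.
    replace (Rpower 1 1) with (Rpower 1 (- alpha)); [apply Anti; lra|].
    unfold Rpower. rewrite ln_1, !Rmult_0_r. reflexivity. }
  exists alpha, (Rpower (1 - r0) (- alpha)).
  split; [exact Ha|]. split; [apply exp_pos|]. intros t r Ht Htr Hr.
  set (K := Rpower (1 - r0) (- alpha)). assert (HK : 1 <= K) by (apply One; lra).
  assert (Hvt : 0 < v t) by (apply Hpos; unfold unit_interval; lra).
  assert (Ht1 : 1 <= Rpower (1 - t) (- alpha)) by (apply One; lra).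
  assert (Hp : 0 < v t * Rpower (1 - t) (- alpha)) by nra.
  destruct (Rle_lt_dec r0 t) as [L|L].
  - specialize (Hdec t r L Htr Hr). nra.
  - apply Rle_trans with (v t * K).
    2: { rewrite (Rmult_comm (v t) K). apply Rmult_le_compat_l; [lra|].
         rewrite <- (Rmult_1_r (v t)) at 1. apply Rmult_le_compat_l; lra. }
    destruct (Rle_lt_dec r0 r) as [L'|L'].
    + eapply Rle_trans; [apply (Hdec r0 r); lra|]. fold K. apply Rmult_le_compat_r; [lra|].
      apply Hmon; unfold unit_interval; lra.
    + apply Rmult_le_compat.
      * left. apply Hpos. unfold unit_interval. lra.
      * left. apply exp_pos.
      * apply Hmon; unfold unit_interval; lra.
      * apply Anti; lra.
Qed.

(** The hypothesis concerns one circle only, so it can be fed either with a global bound or with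
    smallness near the boundary. *)
Lemma derivative_pointwise_bound (v : R -> R) :
  weight v -> eventually_increasing_quotient v ->
  exists K, 0 < K /\ forall f z N, analytic f -> disc z ->
    (forall x, Cmod (x - z) = (1 - Cmod z) / 2 -> Cmod (f x) * v (Cmod x) <= N) ->
    Cmod (C_derive f z) * ((1 - Cmod z) * v (Cmod z)) <= K * N.
Proof.
  intros Hv Hinc. destruct (weight_half_step v Hv Hinc) as [K [HK Hstep]].
  destruct Hv as [_ [Hpos Hmon]].
  (* [K] compares the weights along the circle, and 2 comes from its radius [(1 - r) / 2]. *)
  exists (2 * K). split; [lra|]. intros f z N Hf Hz HN. unfold disc in Hz.
  set (r := Cmod z) in *. pose proof (Cmod_ge_0 z) as Hr. fold r in Hr.
  assert (Hvr : 0 < v r) by (apply Hpos; unfold unit_interval; lra).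
  assert (A : Cmod (C_derive f z) <= (K * N / v r) / ((1 - r) / 2)).
  { apply cauchy_estimate; [exact Hf | lra | fold r; lra |].
    intros x Hx. specialize (HN x Hx).
    assert (Hxr : Cmod x <= (1 + r) / 2).
    { pose proof (Cmod_le_add_minus x z) as T. fold r in T. lra. }
    pose proof (Cmod_ge_0 x) as Hx0. pose proof (Cmod_ge_0 (f x)) as Hfx.
    assert (Hvx : v r <= K * v (Cmod x)).
    { destruct (Rle_lt_dec r (Cmod x)) as [L|L]; [apply Hstep; lra|].
      (* For points closer to 0 than [z] monotonicity suffices; [Hstep] with [s = r] only supplies
         that [K] is at least 1. *)
      apply Rle_trans with (K * v r).
      - apply Hstep; lra.
      - apply Rmult_le_compat_l; [lra|]. apply Hmon; unfold unit_interval; lra. }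
    apply Rle_div_r; [exact Hvr|].
    apply Rle_trans with (Cmod (f x) * (K * v (Cmod x))); [apply Rmult_le_compat_l; assumption|].
    replace (Cmod (f x) * (K * v (Cmod x))) with (K * (Cmod (f x) * v (Cmod x))) by ring.
    apply Rmult_le_compat_l; lra. }
  apply Rle_trans with ((K * N / v r) / ((1 - r) / 2) * ((1 - r) * v r)).
  - apply Rmult_le_compat_r; [nra | exact A].
  - right. field. lra.
Qed.

(** With [M = 0] this is the norm estimate for [op_J]. A positive [M] allows [N] to be small when
    the weighted bound [N] holds only near the boundary. *)
Lemma integral_pointwise_bound (v : R -> R) :
  weight v -> eventually_decreasing_quotient v ->
  exists K, 0 < K /\ forall f z M N, analytic f -> disc z -> 0 <= M -> 0 <= N ->
    (forall x, disc x -> Cmod (f x) <= M + N / ((1 - Cmod x) * v (Cmod x))) ->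
    Cmod (integral_from_0 f z) * v (Cmod z) <= M * v (Cmod z) + K * N.
Proof.
  intros Hv Hdec. destruct (weight_decreasing_quotient v Hv Hdec) as [alpha [K [Ha [HK Hq]]]].
  destruct Hv as [_ [Hpos Hmon]].
  exists (K / alpha). split; [apply Rdiv_lt_0_compat; lra|]. intros f z M N Hf Hz HM HN Hfb.
  unfold disc in Hz. set (r := Cmod z) in *. pose proof (Cmod_ge_0 z) as Hr. fold r in Hr.
  assert (Hvr : 0 < v r) by (apply Hpos; unfold unit_interval; lra).
  set (B := N * K * Rpower (1 - r) alpha / v r).
  assert (HB : 0 <= B).
  { unfold B. apply Rdiv_le_0_compat; [|exact Hvr].
    pose proof (exp_pos (alpha * ln (1 - r))). unfold Rpower. repeat apply Rmult_le_pos; lra. }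
  set (I := Rpower (1 - r) (- alpha)).
  assert (HI : 0 < I) by apply exp_pos.
  assert (EI : Rpower (1 - r) alpha * I = 1).
  { unfold I. rewrite <- Rpower_plus. replace (alpha + - alpha) with 0 by ring.
    apply Rpower_O. lra. }
  (* The majorant along the radius: the factor [r] comes from the speed of the parametrisation and
     makes [Rpower (1 - t * r) (- alpha) / alpha] a primitive of the power term. *)
  set (k := fun t => M + B * (r * Rpower (1 - t * r) (- alpha - 1))).
  assert (Ik : is_RInt k 0 1 (M + B * ((I - 1) / alpha))).
  { evar_last.
    - apply (is_RInt_derive (V := R_CompleteNormedModule)
        (fun t => M * t + B * (Rpower (1 - t * r) (- alpha) / alpha)));
        intros t; rewrite Rmin_left, Rmax_right by lra; intros Ht.
      + assert (0 < 1 - t * r) by nra. unfold k, Rpower.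
        auto_derive; [repeat split; lra|].
        replace ((- alpha - 1) * ln (1 - t * r)) with (- alpha * ln (1 - t * r) + - ln (1 - t * r))
          by ring.
        rewrite exp_plus, exp_Ropp, exp_ln by assumption.
        replace (1 + - (t * r)) with (1 - t * r) by ring. field. lra.
      + assert (0 < 1 - t * r) by nra. unfold k, Rpower.
        apply (ex_derive_continuous (K := R_AbsRing) (V := R_NormedModule)).
        auto_derive. repeat split; lra.
    - unfold minus, plus, opp; simpl. rewrite !Rmult_1_l, Rmult_0_l, Rminus_0_r.
      fold I. replace (Rpower 1 (- alpha)) with 1 by (unfold Rpower; rewrite ln_1, Rmult_0_r, exp_0; reflexivity).
      field. lra. }
  assert (A : Cmod (integral_from_0 f z) <= M + B * ((I - 1) / alpha)).
  { rewrite integral_from_0_seg_int. unfold seg_int. apply (CInt_mod_le_integral) with (k := k).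
    - lra.
    - intros t Ht. apply seg_integrand_continuous, analytic_cont; [exact Hf|].
      apply disc_segment; [exact Ht | apply disc_0 | exact Hz].
    - intros t Ht. unfold segment.
      replace (0 + RtoC t * (z - 0))%C with (RtoC t * z)%C by ring.
      replace (z - 0)%C with z by ring. rewrite Cmod_mult. fold r.
      assert (Htr : Cmod (RtoC t * z) = t * r) by (apply Cmod_RtoC_mult; lra).
      assert (H0 : 0 <= t * r <= r) by nra.
      specialize (Hfb (RtoC t * z)%C). unfold disc in Hfb. rewrite Htr in Hfb.
      specialize (Hfb ltac:(lra)).
      assert (Hvt : 0 < v (t * r)) by (apply Hpos; unfold unit_interval; lra).
      specialize (Hq (t * r) r ltac:(lra) ltac:(lra) ltac:(lra)). fold I in Hq.
      assert (Hp : 0 < Rpower (1 - t * r) (- alpha)) by apply exp_pos.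
      set (p := Rpower (1 - t * r) (- alpha)) in *.
      assert (Ep : Rpower (1 - t * r) (- alpha - 1) = p / (1 - t * r)).
      { unfold p. replace (- alpha - 1) with (- alpha + - (1)) by ring.
        rewrite Rpower_plus, (Rpower_Ropp _ 1), Rpower_1 by lra. reflexivity. }
      (* The decreasing quotient between [t * r] and [r], solved for [/ v (t * r)]. *)
      assert (Q : / v (t * r) <= K * Rpower (1 - r) alpha * p / v r).
      { apply Rle_div_r; [exact Hvr|].
        apply Rmult_le_reg_r with (v (t * r)); [exact Hvt|].
        replace (/ v (t * r) * v r * v (t * r)) with (v r) by (field; lra).
        replace (v r) with (v r * I * Rpower (1 - r) alpha)
          by (rewrite Rmult_assoc, (Rmult_comm I), EI; ring).
        replace (K * Rpower (1 - r) alpha * p * v (t * r))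
          with (K * (v (t * r) * p) * Rpower (1 - r) alpha) by ring.
        apply Rmult_le_compat_r; [left; apply exp_pos | exact Hq]. }
      unfold k. rewrite Ep.
      apply Rle_trans with ((M + N / ((1 - t * r) * v (t * r))) * r);
        [apply Rmult_le_compat_r; assumption|].
      replace ((M + N / ((1 - t * r) * v (t * r))) * r)
        with (M * r + (N * (r / (1 - t * r))) * / v (t * r)) by (field; lra).
      replace (B * (r * (p / (1 - t * r))))
        with ((N * (r / (1 - t * r))) * (K * Rpower (1 - r) alpha * p / v r))
        by (unfold B; field; lra).
      apply Rplus_le_compat; [nra|].
      apply Rmult_le_compat_l; [|exact Q].
      apply Rmult_le_pos; [exact HN|]. apply Rdiv_le_0_compat; lra.
    - exact Ik. }
  apply Rle_trans with ((M + B * ((I - 1) / alpha)) * v r).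
  { apply Rmult_le_compat_r; lra. }
  rewrite Rmult_plus_distr_r. apply Rplus_le_compat_l.
  (* Here the prefactor [(1 - r)^alpha] in [B] cancels the growth of [I], leaving
     [1 - (1 - r)^alpha <= 1]. *)
  replace (B * ((I - 1) / alpha) * v r)
    with (N * K / alpha * (Rpower (1 - r) alpha * I - Rpower (1 - r) alpha))
    by (unfold B; field; lra).
  rewrite EI. replace (K / alpha * N) with (N * K / alpha * 1) by (field; lra).
  apply Rmult_le_compat_l.
  - apply Rdiv_le_0_compat; [nra | exact Ha].
  - pose proof (exp_pos (alpha * ln (1 - r))). unfold Rpower. lra.
Qed.

(** * Weighted spaces *)

Lemma sup_norm_ge (v : R -> R) (f : C -> C) (z : C) :
  disc z -> Rbar_le (Cmod (f z) * v (Cmod z)) (sup_norm v f).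
Proof.
  intros Hz. apply (proj1 (Lub_Rbar_correct
    (fun y : R => exists z : C, disc z /\ y = Cmod (f z) * v (Cmod z)))).
  exists z. split; [exact Hz | reflexivity].
Qed.

(** [real] sends infinite values to 0, so [fnorm] is a genuine bound only after finiteness has been
    established. *)
Lemma sup_norm_finite (v : R -> R) (f : C -> C) :
  Rbar_lt (sup_norm v f) p_infty -> weighted_bound v f (real (sup_norm v f)).
Proof.
  intros H z Hz. pose proof (sup_norm_ge v f z Hz) as G.
  destruct (sup_norm v f) as [l| |]; simpl in *; [exact G | contradiction | contradiction].
Qed.

Lemma sup_norm_le (v : R -> R) (f : C -> C) (N : R) :
  weighted_bound v f N -> Rbar_lt (sup_norm v f) p_infty /\ real (sup_norm v f) <= N.
Proof.
  intros H.
  assert (L : Rbar_le (sup_norm v f) N).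
  { apply (proj2 (Lub_Rbar_correct
      (fun y : R => exists z : C, disc z /\ y = Cmod (f z) * v (Cmod z)))).
    intros y [z [Hz ->]]. exact (H z Hz). }
  (* The value at 0 excludes [m_infty]. *)
  pose proof (sup_norm_ge v f (RtoC 0) disc_0) as G.
  destruct (sup_norm v f) as [l| |]; simpl in *; [split; trivial | contradiction | contradiction].
Qed.

Lemma weighted_bound_nonneg (v : R -> R) (f : C -> C) (N : R) :
  0 <= v 0 -> weighted_bound v f N -> 0 <= N.
Proof.
  intros Hv H. specialize (H (RtoC 0) disc_0). rewrite Cmod_0 in H.
  pose proof (Cmod_ge_0 (f (RtoC 0))). nra.
Qed.

Lemma weighted_bound_ext (v : R -> R) (f h : C -> C) (N : R) :
  (forall z, disc z -> f z = h z) -> weighted_bound v f N -> weighted_bound v h N.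
Proof. intros E H z Hz. rewrite <- E by exact Hz. apply H, Hz. Qed.

Lemma weighted_bound_minus (v : R -> R) (f h : C -> C) (N M : R) :
  (forall r, 0 <= r < 1 -> 0 <= v r) ->
  weighted_bound v f N -> weighted_bound v h M -> weighted_bound v (fminus f h) (N + M).
Proof.
  intros Hv Hf Hh z Hz. specialize (Hf z Hz). specialize (Hh z Hz).
  specialize (Hv (Cmod z) (conj (Cmod_ge_0 z) Hz)). unfold fminus, Cminus.
  pose proof (Cmod_triangle (f z) (- h z)) as T. rewrite Cmod_opp in T. nra.
Qed.

Lemma weighted_bound_mult (v : R -> R) (f h : C -> C) (N A : R) :
  (forall r, 0 <= r < 1 -> 0 <= v r) -> 0 <= A ->
  (forall z, disc z -> Cmod (h z) <= A) ->
  weighted_bound v f N -> weighted_bound v (fun z => f z * h z)%C (A * N).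
Proof.
  intros Hv HA Hh Hf z Hz. specialize (Hf z Hz). specialize (Hh z Hz).
  specialize (Hv (Cmod z) (conj (Cmod_ge_0 z) Hz)). rewrite Cmod_mult.
  pose proof (Cmod_ge_0 (f z)). pose proof (Cmod_ge_0 (h z)).
  apply Rle_trans with (A * (Cmod (f z) * v (Cmod z))); [|apply Rmult_le_compat_l; assumption].
  replace (Cmod (f z) * Cmod (h z) * v (Cmod z)) with (Cmod (h z) * (Cmod (f z) * v (Cmod z))) by ring.
  apply Rmult_le_compat_r; [|exact Hh]. apply Rmult_le_pos; assumption.
Qed.

Lemma analytic_fminus (f h : C -> C) : analytic f -> analytic h -> analytic (fminus f h).
Proof.
  intros Hf Hh. rewrite analytic_Cdiff in Hf, Hh.
  apply (analytic_intro _ (fun z => C_derive f z - C_derive h z)%C).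
  intros z Hz. apply Cdiff_minus; auto.
Qed.

Lemma C_derive_fminus (f h : C -> C) (z : C) : analytic f -> analytic h -> disc z ->
  C_derive (fminus f h) z = (C_derive f z - C_derive h z)%C.
Proof.
  intros Hf Hh Hz. rewrite analytic_Cdiff in Hf, Hh.
  apply Cdiff_C_derive, Cdiff_minus; auto.
Qed.

Lemma integral_from_0_fminus (f h : C -> C) (z : C) : analytic f -> analytic h -> disc z ->
  integral_from_0 (fminus f h) z = (integral_from_0 f z - integral_from_0 h z)%C.
Proof.
  intros Hf Hh Hz. rewrite !integral_from_0_seg_int.
  apply seg_int_minus; intros t Ht; apply analytic_cont; trivial;
    apply disc_segment; trivial; apply disc_0.
Qed.

Lemma analytic_mult (f h : C -> C) : analytic f -> analytic h -> analytic (fun z => f z * h z)%C.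
Proof.
  intros Hf Hh. rewrite analytic_Cdiff in Hf, Hh.
  apply (analytic_intro _ (fun z => C_derive f z * h z + f z * C_derive h z)%C).
  intros z Hz. apply Cdiff_mult; auto.
Qed.

(** The boundary condition of [H0_weighted], separated from analyticity. *)
Definition vanishing (v : R -> R) (f : C -> C) : Prop :=
  forall eps : R, 0 < eps -> exists r : R, r < 1 /\
    forall z : C, r < Cmod z < 1 -> Cmod (f z) * v (Cmod z) < eps.

Lemma vanishing_mult (v : R -> R) (f h : C -> C) (A : R) :
  (forall r, 0 <= r < 1 -> 0 <= v r) ->
  (forall z, disc z -> Cmod (h z) <= A) ->
  vanishing v f -> vanishing v (fun z => f z * h z)%C.
Proof.
  intros Hv Hh Hf eps He.
  assert (HA : 0 <= A).
  { apply Rle_trans with (1 := Cmod_ge_0 (h (RtoC 0))). apply Hh, disc_0. }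
  destruct (Hf (eps / (A + 1))) as [r [Hr K]]; [apply Rdiv_lt_0_compat; lra|].
  exists r. split; [exact Hr|]. intros z Hz. specialize (K z Hz). specialize (Hh z (proj2 Hz)).
  specialize (Hv (Cmod z) (conj (Cmod_ge_0 z) (proj2 Hz))). rewrite Cmod_mult.
  replace (Cmod (f z) * Cmod (h z) * v (Cmod z)) with ((Cmod (f z) * v (Cmod z)) * Cmod (h z)) by ring.
  pose proof (Cmod_ge_0 (f z)).
  assert (P : 0 <= Cmod (f z) * v (Cmod z)) by (apply Rmult_le_pos; assumption).
  apply Rle_lt_trans with ((Cmod (f z) * v (Cmod z)) * (A + 1)).
  - apply Rmult_le_compat_l; lra.
  - apply Rmult_lt_compat_r with (r := A + 1) in K; [|lra].
    replace (eps / (A + 1) * (A + 1)) with eps in K by (field; lra). exact K.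
Qed.

Lemma vanishing_ext (v : R -> R) (f h : C -> C) :
  (forall z, disc z -> f z = h z) -> vanishing v f -> vanishing v h.
Proof.
  intros E H eps He. destruct (H eps He) as [r [Hr K]]. exists r. split; [exact Hr|].
  intros z Hz. rewrite <- E by exact (proj2 Hz). apply K, Hz.
Qed.

(** Near the boundary the weighted values are below 1, and the rest of the disc is compact. This
    makes the norm of the vanishing space finite. *)
Lemma vanishing_bounded (v : R -> R) (f : C -> C) (B : R) :
  (forall r, 0 <= r < 1 -> 0 <= v r <= B) -> analytic f -> vanishing v f ->
  exists N, weighted_bound v f N.
Proof.
  intros Hv Hf H. destruct (H 1 Rlt_0_1) as [r [Hr K]].
  destruct (bounded_on_closed_disc f r Hf Hr) as [M [HM Hb]].
  exists (M * B + 1). intros z Hz. pose proof (Cmod_ge_0 z) as Hz0.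
  specialize (Hv (Cmod z) (conj Hz0 Hz)).
  destruct (Rle_lt_dec (Cmod z) r) as [L|L].
  - specialize (Hb z L). pose proof (Cmod_ge_0 (f z)).
    assert (Cmod (f z) * v (Cmod z) <= M * B) by (apply Rmult_le_compat; lra). lra.
  - specialize (K z (conj L Hz)). assert (0 <= M * B) by (apply Rmult_le_pos; lra). lra.
Qed.

Lemma vanishing_sup_norm_finite (v : R -> R) (f : C -> C) (B : R) :
  (forall r, 0 <= r < 1 -> 0 <= v r <= B) -> analytic f -> vanishing v f ->
  Rbar_lt (sup_norm v f) p_infty.
Proof.
  intros Hv Hf H. destruct (vanishing_bounded v f B Hv Hf H) as [N HN].
  exact (proj1 (sup_norm_le v f N HN)).
Qed.

(** Additivity on differences reduces continuity to boundedness, with [delta = eps / K]. *)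
Lemma continuous_op_of_bounds (T : (C -> C) -> C -> C) (v w : R -> R) (K : R) :
  0 < K -> (forall r, 0 <= r < 1 -> 0 <= v r) ->
  (forall f, analytic f -> analytic (T f)) ->
  (forall f h z, analytic f -> analytic h -> disc z ->
     T (fminus f h) z = (T f z - T h z)%C) ->
  (forall f N, analytic f -> weighted_bound v f N -> weighted_bound w (T f) (K * N)) ->
  continuous_op T (Hinf_weighted v) (Hinf_weighted w).
Proof.
  intros HK Hv Ta Tm Tb. split.
  - intros f [Hf Hn]. split; [apply Ta, Hf|].
    exact (proj1 (sup_norm_le _ _ _ (Tb f _ Hf (sup_norm_finite _ _ Hn)))).
  - intros f [Hf Hnf] eps He. exists (eps / K). split; [apply Rdiv_lt_0_compat; lra|].
    intros h [Hh Hnh] Hd. simpl in *.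
    assert (Hb : weighted_bound v (fminus h f) (real (sup_norm v (fminus h f)))).
    { apply sup_norm_finite. apply (sup_norm_le _ _ (real (sup_norm v h) + real (sup_norm v f))).
      apply weighted_bound_minus; [exact Hv | |]; apply sup_norm_finite; assumption. }
    apply Tb in Hb; [|apply analytic_fminus; assumption].
    apply (weighted_bound_ext _ _ (fminus (T h) (T f))) in Hb;
      [|intros z Hz; apply Tm; assumption].
    apply Rle_lt_trans with (1 := proj2 (sup_norm_le _ _ _ Hb)).
    apply Rmult_lt_compat_l with (r := K) in Hd; [|exact HK].
    replace (K * (eps / K)) with eps in Hd by (field; lra). exact Hd.
Qed.

(** * The operators [op_D], [op_J] and [op_V] between the weighted spaces *)

Section WeightedOperators.

Context (v w : R -> R).
Context (Hv : weight v).
Context (Hinc : eventually_increasing_quotient v).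
Context (Hdec : eventually_decreasing_quotient v).
Context (Hw : forall r : R, 0 <= r < 1 -> w r = (1 - r) * v r).

Lemma weight_bounds (r : R) : 0 <= r < 1 -> 0 < v r <= v 0.
Proof.
  destruct Hv as [_ [Hpos Hmon]]. intros Hr.
  split; [apply Hpos | apply Hmon]; unfold unit_interval; lra.
Qed.

Lemma product_weight_bounds (r : R) : 0 <= r < 1 -> 0 < w r <= v 0.
Proof.
  intros Hr. rewrite Hw by exact Hr. pose proof (weight_bounds r Hr). nra.
Qed.

Lemma derivative_weighted_bound : exists K, 0 < K /\ forall f N, analytic f ->
  weighted_bound v f N -> weighted_bound w (C_derive f) (K * N).
Proof.
  destruct (derivative_pointwise_bound v Hv Hinc) as [K [HK H]].
  exists K. split; [exact HK|]. intros f N Hf HN z Hz.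
  rewrite Hw by (split; [apply Cmod_ge_0 | exact Hz]).
  apply H; [exact Hf | exact Hz |]. intros x Hx. apply HN.
  unfold disc in *. pose proof (Cmod_le_add_minus x z). lra.
Qed.

Lemma derivative_vanishing (f : C -> C) :
  analytic f -> vanishing v f -> vanishing w (C_derive f).
Proof.
  intros Hf H eps He.
  destruct (derivative_pointwise_bound v Hv Hinc) as [K [HK Hb]].
  destruct (H (eps / (2 * K))) as [r [Hr Hs]]; [apply Rdiv_lt_0_compat; lra|].
  (* The circle of radius [(1 - |z|) / 2] about [z] has points of modulus at least
     [(3 * |z| - 1) / 2], which exceeds [r] exactly when [|z| > (2 * r + 1) / 3]. *)
  exists ((2 * r + 1) / 3). split; [lra|]. intros z [Hz1 Hz].
  rewrite Hw by (split; [apply Cmod_ge_0 | exact Hz]).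
  apply Rle_lt_trans with (K * (eps / (2 * K))).
  - apply Hb; [exact Hf | exact Hz |]. intros x Hx. left. apply Hs.
    pose proof (Cmod_le_add_minus x z). pose proof (Cmod_le_add_minus z x) as T.
    rewrite (Cmod_minus_sym z x) in T. lra.
  - replace (K * (eps / (2 * K))) with (eps / 2) by (field; lra). lra.
Qed.

Lemma integral_weighted_bound : exists K, 0 < K /\ forall f N, analytic f ->
  weighted_bound w f N -> weighted_bound v (integral_from_0 f) (K * N).
Proof.
  destruct (integral_pointwise_bound v Hv Hdec) as [K [HK H]].
  exists K. split; [exact HK|]. intros f N Hf HN z Hz.
  assert (HN0 : 0 <= N).
  { apply (weighted_bound_nonneg w f); [|exact HN]. left. apply product_weight_bounds. lra. }
  replace (K * N) with (0 * v (Cmod z) + K * N) by ring.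
  apply H; try assumption; [lra|]. intros x Hx. specialize (HN x Hx).
  assert (Hxr : 0 <= Cmod x < 1) by (split; [apply Cmod_ge_0 | exact Hx]).
  rewrite <- Hw by exact Hxr. rewrite Rplus_0_l.
  apply Rle_div_r; [apply product_weight_bounds, Hxr | exact HN].
Qed.

(** Smallness of [f] holds only outside some radius [r]; inside, [f] is bounded by [M]. The limit of
    [v] is what removes the contribution of [M]. *)
Lemma integral_vanishing (f : C -> C) :
  filterlim v (at_left 1) (locally 0) ->
  analytic f -> vanishing w f -> vanishing v (integral_from_0 f).
Proof.
  intros Hlim Hf H eps He.
  destruct (integral_pointwise_bound v Hv Hdec) as [K [HK Hb]].
  destruct (H (eps / (2 * K))) as [r [Hr Hs]]; [apply Rdiv_lt_0_compat; lra|].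
  destruct (bounded_on_closed_disc f r Hf Hr) as [M [HM Hfb]].
  assert (He' : 0 < eps / (2 * (M + 1))) by (apply Rdiv_lt_0_compat; lra).
  apply filterlim_locally with (eps := mkposreal _ He') in Hlim.
  destruct Hlim as [d Hd].
  exists (Rmax 0 (1 - d)). split; [apply Rmax_lub_lt; [lra|]; pose proof (cond_pos d); lra|].
  intros z [Hz1 Hz].
  assert (Hz0 : 1 - d < Cmod z) by (apply Rle_lt_trans with (2 := Hz1), Rmax_r).
  assert (Hvz : v (Cmod z) < eps / (2 * (M + 1))).
  { assert (Bd : ball 1 d (Cmod z)).
    { change (Rabs (Cmod z - 1) < d). apply Rabs_def1; lra. }
    specialize (Hd _ Bd Hz). change (Rabs (v (Cmod z) - 0) < eps / (2 * (M + 1))) in Hd.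
    apply Rabs_def2 in Hd. lra. }
  apply Rle_lt_trans with (M * v (Cmod z) + K * (eps / (2 * K))).
  - apply Hb; [exact Hf | exact Hz | exact HM | left; apply Rdiv_lt_0_compat; lra |].
    intros x Hx. assert (Hxr : 0 <= Cmod x < 1) by (split; [apply Cmod_ge_0 | exact Hx]).
    rewrite <- Hw by exact Hxr. pose proof (product_weight_bounds _ Hxr) as [Hwx _].
    assert (He2 : 0 < eps / (2 * K)) by (apply Rdiv_lt_0_compat; lra).
    destruct (Rle_lt_dec (Cmod x) r) as [L|L].
    + pose proof (Rdiv_lt_0_compat _ _ He2 Hwx). specialize (Hfb x L). lra.
    + specialize (Hs x (conj L Hx)).
      assert (Cmod (f x) <= eps / (2 * K) / w (Cmod x)) by (apply Rle_div_r; lra). lra.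
  - replace (K * (eps / (2 * K))) with (eps / 2) by (field; lra).
    apply Rlt_le_trans with (eps / 2 + eps / 2); [apply Rplus_lt_compat_r | lra].
    pose proof (weight_bounds (Cmod z) (conj (Cmod_ge_0 z) Hz)).
    (* The coefficient [M + 1/2] is positive even for [M = 0], which preserves the strict inequality
       on [v]. *)
    apply Rle_lt_trans with ((M + 1/2) * v (Cmod z)); [nra|].
    apply Rlt_le_trans with ((M + 1/2) * (eps / (2 * (M + 1)))).
    + apply Rmult_lt_compat_l; lra.
    + apply Rle_trans with ((M + 1) * (eps / (2 * (M + 1)))); [apply Rmult_le_compat_r; lra|].
      right. field. lra.
Qed.

Lemma derivative_op_continuous : continuous_op op_D (Hinf_weighted v) (Hinf_weighted w).
Proof.
  destruct derivative_weighted_bound as [K [HK H]].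
  apply (continuous_op_of_bounds _ _ _ K); try assumption.
  - intros r Hr. left. apply weight_bounds, Hr.
  - apply analytic_derivative.
  - apply C_derive_fminus.
Qed.

Lemma integral_op_continuous : continuous_op op_J (Hinf_weighted w) (Hinf_weighted v).
Proof.
  destruct integral_weighted_bound as [K [HK H]].
  apply (continuous_op_of_bounds _ _ _ K); try assumption.
  - intros r Hr. left. apply product_weight_bounds, Hr.
  - apply analytic_integral_from_0.
  - apply integral_from_0_fminus.
Qed.

Context (g : C -> C).
Context (Hg' : Hinf (C_derive g)).
Context (Hg'inv : inv_Hinf (C_derive g)).

Lemma analytic_op_V (f : C -> C) : analytic f -> analytic (op_V g f).
Proof. intros Hf. apply analytic_integral_from_0, analytic_mult; [exact Hf | apply Hg']. Qed.

(** Differentiating and dividing by [g'] inverts [op_V]; the converse estimates for [f] are read off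
    from this identity. *)
Lemma C_derive_op_V (f : C -> C) (z : C) : analytic f -> disc z ->
  (C_derive (op_V g f) z * / C_derive g z)%C = f z.
Proof.
  intros Hf Hz.
  assert (E : C_derive (op_V g f) z = (f z * C_derive g z)%C).
  { apply Cdiff_C_derive.
    apply (integral_from_0_Cdiff (fun xi => f xi * C_derive g xi)%C z); [|exact Hz].
    apply analytic_mult; [exact Hf | apply Hg']. }
  rewrite E. field. apply (proj1 Hg'inv), Hz.
Qed.

Lemma bounded_pos_bound (h : C -> C) :
  Hinf h -> exists A, 0 < A /\ forall z, disc z -> Cmod (h z) <= A.
Proof.
  intros [_ [M HM]]. exists (Rabs M + 1). split; [pose proof (Rabs_pos M); lra|].
  intros z Hz. specialize (HM z Hz). pose proof (Rle_abs M). lra.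
Qed.

Lemma op_V_weighted_bound : exists K, 0 < K /\ forall f N, analytic f ->
  weighted_bound w f N -> weighted_bound v (op_V g f) (K * N).
Proof.
  destruct integral_weighted_bound as [K [HK H]].
  destruct (bounded_pos_bound _ Hg') as [A [HA HgA]].
  exists (K * A). split; [nra|]. intros f N Hf HN. rewrite Rmult_assoc.
  apply H; [apply analytic_mult; [exact Hf | apply Hg']|].
  apply weighted_bound_mult; try assumption; [|lra].
  intros r Hr. left. apply product_weight_bounds, Hr.
Qed.

Lemma op_V_weighted_bound_inv : exists K, 0 < K /\ forall f N, analytic f ->
  weighted_bound v (op_V g f) N -> weighted_bound w f (K * N).
Proof.
  destruct derivative_weighted_bound as [K [HK H]].
  destruct (bounded_pos_bound _ (proj2 Hg'inv)) as [A [HA HgA]].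
  exists (A * K). split; [nra|]. intros f N Hf HN. rewrite Rmult_assoc.
  apply (weighted_bound_ext _ (fun z => C_derive (op_V g f) z * / C_derive g z)%C).
  - intros z Hz. apply C_derive_op_V; assumption.
  - apply weighted_bound_mult; try assumption; [|lra | apply H; [apply analytic_op_V, Hf | exact HN]].
    intros r Hr. left. apply product_weight_bounds, Hr.
Qed.

Lemma op_V_vanishing (f : C -> C) : filterlim v (at_left 1) (locally 0) ->
  analytic f -> vanishing w f -> vanishing v (op_V g f).
Proof.
  intros Hlim Hf H. destruct (bounded_pos_bound _ Hg') as [A [_ HgA]].
  apply integral_vanishing; [exact Hlim | apply analytic_mult; [exact Hf | apply Hg'] |].
  apply (vanishing_mult _ _ _ A); try assumption.
  intros r Hr. left. apply product_weight_bounds, Hr.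
Qed.

Lemma op_V_vanishing_inv (f : C -> C) :
  analytic f -> vanishing v (op_V g f) -> vanishing w f.
Proof.
  intros Hf H. destruct (bounded_pos_bound _ (proj2 Hg'inv)) as [A [_ HgA]].
  apply (vanishing_ext _ (fun z => C_derive (op_V g f) z * / C_derive g z)%C).
  - intros z Hz. apply C_derive_op_V; assumption.
  - apply (vanishing_mult _ _ _ A); try assumption.
    + intros r Hr. left. apply product_weight_bounds, Hr.
    + apply derivative_vanishing; [apply analytic_op_V, Hf | exact H].
Qed.

(** Stated under finiteness of the sup-norm alone, so that it applies to both scales of spaces,
    which share their norm. *)
Lemma op_V_norms_equivalent : exists a b, 0 < a /\ 0 < b /\ forall f, analytic f ->
  Rbar_lt (sup_norm v (op_V g f)) p_infty ->
  a * real (sup_norm w f) <= real (sup_norm v (op_V g f)) /\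
  real (sup_norm v (op_V g f)) <= b * real (sup_norm w f).
Proof.
  destruct op_V_weighted_bound as [b [Hb H]].
  destruct op_V_weighted_bound_inv as [c [Hc H']].
  exists (/ c), b. split; [apply Rinv_0_lt_compat, Hc|]. split; [exact Hb|].
  intros f Hf Hn. specialize (H' f _ Hf (sup_norm_finite _ _ Hn)).
  destruct (sup_norm_le _ _ _ H') as [Hfin Hle]. split.
  - apply Rmult_le_reg_l with c; [exact Hc|]. rewrite <- Rmult_assoc, Rinv_r, Rmult_1_l by lra.
    exact Hle.
  - apply sup_norm_le, H; [exact Hf|]. apply sup_norm_finite, Hfin.
Qed.

Lemma op_V_optimal_domain_Hinf :
  equal_with_equivalent_norms (optimal_domain (op_V g) (Hinf_weighted v)) (Hinf_weighted w).
Proof.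
  split.
  - intros f. simpl. split.
    + intros [Hf [_ Hn]]. split; [exact Hf|].
      destruct op_V_weighted_bound_inv as [c [Hc H]].
      exact (proj1 (sup_norm_le _ _ _ (H f _ Hf (sup_norm_finite _ _ Hn)))).
    + intros [Hf Hn]. split; [exact Hf|]. split; [apply analytic_op_V, Hf|].
      destruct op_V_weighted_bound as [c [Hc H]].
      exact (proj1 (sup_norm_le _ _ _ (H f _ Hf (sup_norm_finite _ _ Hn)))).
  - destruct op_V_norms_equivalent as [a [b [Ha [Hb H]]]].
    exists a, b. split; [exact Ha|]. split; [exact Hb|]. intros f [Hf [_ Hn]].
    exact (H f Hf Hn).
Qed.

Lemma op_V_optimal_domain_H0 : filterlim v (at_left 1) (locally 0) ->
  equal_with_equivalent_norms (optimal_domain (op_V g) (H0_weighted v)) (H0_weighted w).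
Proof.
  intros Hlim. split.
  - intros f. simpl. split.
    + intros [Hf [_ Hn]]. split; [exact Hf|]. apply op_V_vanishing_inv; assumption.
    + intros [Hf Hn]. split; [exact Hf|]. split; [apply analytic_op_V, Hf|].
      apply op_V_vanishing; assumption.
  - destruct op_V_norms_equivalent as [a [b [Ha [Hb H]]]].
    exists a, b. split; [exact Ha|]. split; [exact Hb|]. intros f [Hf [Hvf Hn]].
    (* Membership here gives only decay at the boundary, so finiteness of the norm has to be derived
       from it. *)
    apply (H f Hf). apply (vanishing_sup_norm_finite _ _ (v 0)); try assumption.
    intros r Hr. pose proof (weight_bounds r Hr). lra.
Qed.

End WeightedOperators.

Theorem proposition3p6
  (g : C -> C) (v w : R -> R)
  (Hg : analytic g)
  (Hg' : Hinf (C_derive g))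
  (Hg'inv : inv_Hinf (C_derive g))
  (Hv : weight v)
  (Hlog : log_convex v)
  (Hinc : eventually_increasing_quotient v)
  (Hdec : eventually_decreasing_quotient v)
  (Hw : forall r : R, 0 <= r < 1 -> w r = (1 - r) * v r) :
  (continuous_op op_D (Hinf_weighted v) (Hinf_weighted w) /\
   continuous_op op_J (Hinf_weighted w) (Hinf_weighted v)) /\
  (continuous_op (op_V g) (Hinf_weighted v) (Hinf_weighted v) ->
   equal_with_equivalent_norms (optimal_domain (op_V g) (Hinf_weighted v)) (Hinf_weighted w)) /\
  (filterlim v (at_left 1) (locally 0) ->
   continuous_op (op_V g) (H0_weighted v) (H0_weighted v) ->
   equal_with_equivalent_norms (optimal_domain (op_V g) (H0_weighted v)) (H0_weighted w)).
Proof.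
  split; [split|split].
  - exact (derivative_op_continuous v w Hv Hinc Hw).
  - exact (integral_op_continuous v w Hv Hdec Hw).
  - intros _. exact (op_V_optimal_domain_Hinf v w Hv Hinc Hdec Hw g Hg' Hg'inv).
  - intros Hlim _. exact (op_V_optimal_domain_H0 v w Hv Hinc Hdec Hw g Hg' Hg'inv Hlim).
Qed.
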